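(* Consider the conjugate Gibbs sampler (defined in the context) for regularized Bayesian bridge probit regression, with bridge exponent $a\in(0,1)$, fixed slab width $\zeta>0$, arbitrary design matrix $\boldsymbol X\in\mathbb R^{n\times p}$ and binary outcomes $\boldsymbol y\in\{0,1\}^n$. If the global scale prior $\pi_{\rm glo}(\cdot)$ is supported on $[\tau_{\min},\infty)$ for some $\tau_{\min}>0$, then the sampler is uniformly ergodic.
   Context: Model: $y_i\mid\boldsymbol x_i,\boldsymbol\beta\sim\mathrm{Bernoulli}(\Phi(\boldsymbol x_i^\top\boldsymbol\beta))$, with $\Phi$ the standard Gaussian cumulative distribution function and $\boldsymbol x_i^\top$ the rows of $\boldsymbol X$; fictitious data $z_j=0$ with $z_j\mid\beta_j\sim\mathcal N(\beta_j,\zeta^2)$; $\beta_j\mid\tau,\lambda_j\sim\mathcal N(0,\tau^2\lambda_j^2)$, $\lambda_j\sim\pi_{\rm loc}$ independently for $j=1,\dots,p$, $\tau\sim\pi_{\rm glo}$. Bayesian bridge prior: $\pi_{\rm loc}(\lambda)\propto\lambda^{-2}\pi_{\rm st}(\lambda^{-2}/2)$ on $(0,\infty)$, where $\pi_{\rm st}$ is the density of the one-sided (positive) stable distribution with characteristic exponent $a/2$, characterized by $\int_0^\infty e^{-su}\pi_{\rm st}(u)\,du=\exp(-s^{a/2})$, $s\ge0$. The resulting marginal is $\pi(\beta_j\mid\tau)\propto\tau^{-1}\exp(-|\beta_j/\tau|^a)$. Conjugate Gibbs sampler: a transition $(\boldsymbol\beta^*,\boldsymbol\lambda^*,\tau^*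 )\to(\boldsymbol\beta,\boldsymbol\lambda,\tau)$ consists of: (1) draw $\tau$ from the collapsed conditional $\pi(\tau\mid\boldsymbol\beta^* )\propto\pi_{\rm glo}(\tau)\,\tau^{-p}\prod_j\exp(-|\beta_j^*/\tau|^a)$; (2) draw $\lambda_j$ independently from $\pi(\lambda_j\mid\beta_j^*,\tau)\propto\lambda_j^{-1}\exp(-\beta_j^{*2}/(2\tau^2\lambda_j^2))\,\pi_{\rm loc}(\lambda_j)$; (3) draw $\boldsymbol\beta$ from the density proportional to $\prod_i\Phi(\boldsymbol x_i^\top\boldsymbol\beta)^{y_i}(1-\Phi(\boldsymbol x_i^\top\boldsymbol\beta))^{1-y_i}\,\prod_j\exp\!\big(-\tfrac12(\zeta^{-2}+\tau^{-2}\lambda_j^{-2})\beta_j^2\big)$. Uniform ergodicity: there are $M<\infty$, $\rho<1$ such that the total variation distance between the $k$-step distribution from any starting point and the stationary distribution is at most $M\rho^k$ for all $k$. *)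

(* Defs.v *)
From HB Require Import structures.
From mathcomp Require Import all_boot all_order all_algebra.
From mathcomp Require Import all_classical all_reals all_analysis.
From mathcomp Require Import measurable_realfun.

Set Implicit Arguments.
Unset Strict Implicit.
Unset Printing Implicit Defensive.
Import Order.TTheory GRing.Theory Num.Theory.
Import numFieldNormedType.Exports.

Local Open Scope classical_set_scope.
Local Open Scope ring_scope.

Definition tuple_cons (T : Type) (n : nat) (z : T * n.-tuple T) : n.+1.-tuple T :=
  [tuple of z.1 :: z.2].

Lemma measurable_tuple_cons d (T : measurableType d) (n : nat) :
  measurable_fun [set: T * n.-tuple T] (@tuple_cons T n).
Proof. by apply: measurable_cons. Qed.

Section lebesgue_tuple.
Context {R : realType}.
Local Notation RT := (measurableTypeR R).

Section step.
Variables (n : nat) (m : {sigma_finite_measure set (n.-tuple RT) -> \bar R}).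

Definition lebesgue_step : set (n.+1.-tuple RT) -> \bar R :=
  pushforward (@lebesgue_measure R \x m)%E (@tuple_cons RT n).

Let mu : {measure set (RT * n.-tuple RT)%type -> \bar R} := (@lebesgue_measure R \x m)%E.
Let nu : {measure set (n.+1.-tuple RT) -> \bar R} :=
  measure_function_pushforward__canonical__measure_function_Measure
    mu (@measurable_tuple_cons _ RT n).

HB.instance Definition _ := isMeasure.Build _ _ _ lebesgue_step
  (measure0 nu) (measure_ge0 nu) (@measure_semi_sigma_additive _ _ _ nu).

Let sigma_finite_lebesgue_step : sigma_finite setT lebesgue_step.
Proof.
have /sigma_finiteP[F [TF ndF Foo]] := sigma_finiteT (@lebesgue_measure R).
have /sigma_finiteP[G [TG ndG Goo]] := sigma_finiteT m.
pose g (t : n.+1.-tuple RT) : RT * n.-tuple RT := (thead t, [tuple of behead t]).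
have mg : measurable_fun setT g.
  apply: measurable_fun_pair; first exact: measurable_tnth.
  exact: measurable_behead.
have gK : g \o @tuple_cons RT n = id.
  by apply/funext => -[x t]; congr pair; rewrite /= ?theadE//; exact/val_inj.
exists (fun k => g @^-1` (F k `*` G k)).
  apply/esym/seteqP; split=> // t _.
  have [i _ Fi] : (\bigcup_i F i) (thead t) by rewrite -TF.
  have [j _ Gj] : (\bigcup_j G j) [tuple of behead t] by rewrite -TG.
  exists (maxn i j) => //; split => /=.
    by move: Fi; exact/subsetPset/ndF/leq_maxl.
  by move: Gj; exact/subsetPset/ndG/leq_maxr.
move=> k; have [mF Fk] := Foo k; have [mG Gk] := Goo k.
split; first by rewrite -[X in measurable X]setTI; apply: mg => //; exact: measurableX.
rewrite /lebesgue_step /pushforward -comp_preimage gK preimage_id.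
by rewrite product_measure1E// lte_mul_pinfty// ge0_fin_numE.
Qed.

HB.instance Definition _ := Measure_isSigmaFinite.Build _ _ _ lebesgue_step
  sigma_finite_lebesgue_step.

End step.

(* Lebesgue measure on R^n, as the n-fold product of one-dimensional Lebesgue
   measure; on R^0 it is the point mass. *)
Fixpoint lebesgue_tuple (n : nat) : {sigma_finite_measure set (n.-tuple RT) -> \bar R} :=
  if n is n'.+1 then lebesgue_step (lebesgue_tuple n') else \d_[tuple].

End lebesgue_tuple.

Section kernels.
Context {R : realType}.

Section kdensity.
Context d d' (X : measurableType d) (Y : measurableType d').
Variables (mu : {sigma_finite_measure set Y -> \bar R}) (f : X * Y -> R).
Hypotheses (mf : measurable_fun [set: X * Y] f) (f0 : forall z, 0 <= f z).

Definition density_measure (x : X) (A : set Y) : \bar R :=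
  (\int[mu]_(y in A) (f (x, y))%:E)%E.

Let mfx x : measurable_fun [set: Y] (fun y => (f (x, y))%:E).
Proof. by apply/measurable_EFinP; exact: measurable_fun_pair2. Qed.

Let density0 x : density_measure x set0 = 0%E.
Proof. exact: integral_set0. Qed.

Let density_ge0 x A : (0 <= density_measure x A)%E.
Proof. by apply: integral_ge0 => y _; rewrite lee_fin. Qed.

Let density_sigma_additive x : semi_sigma_additive (density_measure x).
Proof.
move=> /= F mF tF mUF; rewrite /density_measure ge0_integral_bigcup//=.
- apply: is_cvg_ereal_nneg_natsum_cond => n _ _.
  by apply: integral_ge0 => y _; rewrite lee_fin.
- exact: measurable_funTS.
- by move=> y _; rewrite lee_fin.
Qed.

HB.instance Definition _ x := isMeasure.Build _ _ _ (density_measure x)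
  (density0 x) (density_ge0 x) (@density_sigma_additive x).

Definition kdensity : X -> {measure set Y -> \bar R} := density_measure.

Let measurable_kdensity U : measurable U -> measurable_fun [set: X] (kdensity ^~ U).
Proof.
move=> mU.
rewrite (_ : kdensity ^~ U =
    fubini_F mu (fun z => (f z)%:E * (\1_U z.2)%:E)%E); last first.
  apply/funext => x; rewrite /kdensity /= /density_measure /fubini_F.
  rewrite [LHS]integral_mkcond; apply: eq_integral => y _ /=.
  by rewrite patchE indicE; case: ifPn => _; rewrite ?mule1 ?mule0.
apply: measurable_fun_fubini_tonelli_F => [|z]; last first.
  by rewrite mule_ge0 ?lee_fin// indicE; case: (_ \in _).
apply: emeasurable_funM; first exact/measurable_EFinP.
apply/measurable_EFinP; apply: measurableT_comp => //.
Qed.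

HB.instance Definition _ := isKernel.Build _ _ X Y R kdensity measurable_kdensity.

(* The law with density proportional to f (x, .) with respect to mu.  Where the
   total mass of f (x, .) is 0 or +oo, there is no such law and the value is the
   point mass at y0. *)
Definition kdraw (y0 : Y) : R.-pker X ~> Y := knormalize kdensity \d_y0.

End kdensity.

Section kbind.
Context d d' d'' (X : measurableType d) (Y : measurableType d') (Z : measurableType d'').
Variables (l : R.-pker X ~> Y) (k : R.-pker (X * Y) ~> Z).

Definition kbind_subdef : X -> {measure set Z -> \bar R} := (l \; k)%E.

HB.instance Definition _ := Kernel.on kbind_subdef.

Let kbind_setT x : kbind_subdef x setT = 1%E.
Proof.
rewrite /kbind_subdef /= /kcomp.
under eq_integral do rewrite prob_kernel.
by rewrite integral_cst// prob_kernel mule1.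
Qed.

HB.instance Definition _ := Kernel_isProbability.Build _ _ _ _ _ kbind_subdef kbind_setT.

(* Draw v from l u, then draw from k (u, v), and forget v. *)
Definition kbind : R.-pker X ~> Z := kbind_subdef.

End kbind.

Section kpre.
Context d d' d'' (X : measurableType d) (Y : measurableType d') (Z : measurableType d'').
Variables (k : R.-pker X ~> Z) (f : Y -> X) (mf : measurable_fun [set: Y] f).

Definition kpre_subdef of measurable_fun [set: Y] f :
  Y -> {measure set Z -> \bar R} := fun y => k (f y).

Let measurable_kpre U : measurable U -> measurable_fun [set: Y] (kpre_subdef mf ^~ U).
Proof. by move=> mU; exact: measurableT_comp (measurable_kernel k U mU) mf. Qed.

HB.instance Definition _ := isKernel.Build _ _ Y Z R (kpre_subdef mf) measurable_kpre.

Let kpre_setT y : kpre_subdef mf y setT = 1%E.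
Proof. exact: prob_kernel. Qed.

HB.instance Definition _ := Kernel_isProbability.Build _ _ _ _ _ (kpre_subdef mf) kpre_setT.

Definition kpre : R.-pker Y ~> Z := kpre_subdef mf.

End kpre.

Section kindep.
Context d d' (X : measurableType d) (Y : measurableType d').

Definition cons_step n (z : X * Y * n.-tuple Y) : n.+1.-tuple Y :=
  tuple_cons (z.1.2, z.2).

Lemma measurable_cons_step n : measurable_fun setT (@cons_step n).
Proof.
apply: (@measurable_cons _ _ _ _ (fun z : X * Y * n.-tuple Y => z.1.2) n snd).
  exact: (measurableT_comp measurable_snd measurable_fst).
exact: measurable_snd.
Qed.

(* The law of (V_0, ..., V_(n-1)) with the V_i independent, V_i drawn from k i. *)
Fixpoint kindep (n : nat) : ('I_n -> R.-pker X ~> Y) -> R.-pker X ~> n.-tuple Y :=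
  match n with
  | 0 => fun=> kdirac (measurable_cst [tuple])
  | n'.+1 => fun k =>
      kbind (k ord0)
        (kbind (kpre (kindep (fun i => k (lift ord0 i))) measurable_fst)
               (kdirac (@measurable_cons_step n')))
  end.

End kindep.

Section ergodicity.
Context d (T : measurableType d).

(* The law of the chain after k transitions from x. *)
Fixpoint kstep (P : R.-pker T ~> T) (k : nat) (x : T) (A : set T) : \bar R :=
  if k is k'.+1 then (\int[P x]_y kstep P k' y A)%E else \d_x A.

Definition total_variation_distance (mu nu : set T -> \bar R) : \bar R :=
  ereal_sup [set `|mu A - nu A|%E | A in measurable].

Definition stationary (P : R.-pker T ~> T) (pi : probability T R) : Prop :=
  forall A, measurable A -> (\int[pi]_x P x A)%E = pi A.

(* S is the state space of the chain, which T may strictly contain. *)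
Definition uniformly_ergodic (S : set T) (P : R.-pker T ~> T) : Prop :=
  exists pi : probability T R, [/\ pi S = 1%E, stationary P pi &
    exists M rho : R, [/\ 0 <= rho, rho < 1 &
      forall (x : T) (k : nat), S x ->
        (total_variation_distance (kstep P k x) pi <= (M * rho ^+ k)%:E)%E]].

End ergodicity.

End kernels.

Section half_line_density.
Context {R : realType}.

(* Probability densities on (0, +oo), extended by 0 to the real line. *)
Record density := Density {
  density_fun :> R -> R ;
  measurable_density : measurable_fun [set: R] density_fun ;
  density_ge0 : forall x, 0 <= density_fun x ;
  density_le0 : forall x, x <= 0 -> density_fun x = 0 ;
  integral_density : (\int[@lebesgue_measure R]_x (density_fun x)%:E = 1)%E }.

Definition positive_stable_density (alpha : R) (f : density) : Prop :=
  forall s : R, 0 <= s ->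
    (\int[@lebesgue_measure R]_(u in `]0%R, +oo[) (expR (- (s * u)) * f u)%:E
      = (expR (- (s `^ alpha)))%:E)%E.

Definition bridge_local_prior (pi_st pi_loc : density) : Prop :=
  exists2 c : R, 0 < c &
    forall l, 0 < l -> pi_loc l = c * (l ^- 2 * pi_st (l ^- 2 / 2)).

End half_line_density.
Arguments density : clear implicits.

Definition Phi {R : realType} (x : R) : R := fine (normal_prob 0 1 `]-oo, x]).

Section gibbs_weights.
Context {R : realType} (n p : nat).
Local Notation RT := (measurableTypeR R).
Local Notation vec := (p.-tuple RT).

Variables (X : 'M[R]_(n, p)) (y : 'I_n -> bool) (zeta a : R).
Variables (pi_loc pi_glo : density R).

(* Unnormalized densities of the three conditional draws.  The factors pi_glo
   and pi_loc make the first two vanish off (0, +oo). *)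
Definition tau_weight (beta : vec) (tau : R) : R :=
  pi_glo tau * tau ^- p * \prod_(j < p) expR (- (`|tnth beta j / tau| `^ a)).

Definition lambda_weight (betaj tau l : R) : R :=
  l^-1 * expR (- (betaj ^+ 2 / (2 * tau ^+ 2 * l ^+ 2))) * pi_loc l.

Definition predictor (beta : vec) (i : 'I_n) : R := \sum_(j < p) X i j * tnth beta j.

Definition beta_weight (tau : R) (lambda beta : vec) : R :=
  (\prod_(i < n) (Phi (predictor beta i) ^+ y i * (1 - Phi (predictor beta i)) ^+ (1 - y i))) *
  \prod_(j < p) expR (- (2^-1 * (zeta ^- 2 + tau ^- 2 * tnth lambda j ^- 2) * tnth beta j ^+ 2)).

Lemma measurable_invr : measurable_fun [set: R] (fun x : R => x^-1).
Proof.
have -> : [set: R] = [set~ 0] `|` [set 0] by rewrite setUC setUCr.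
apply/measurable_funU; [exact: measurableC|exact: measurable_set1|split].
  apply: open_continuous_measurable_fun; first exact: closed_openC.
  by apply/in_setP => x /= /eqP x0; exact: inv_continuous.
by apply: measurable_fun_set1.
Qed.

Lemma Phi_ge0 (x : R) : 0 <= Phi x.
Proof. exact: fine_ge0. Qed.

Lemma Phi_le1 (x : R) : Phi x <= 1.
Proof.
rewrite -lee_fin fineK ?fin_num_measure//.
exact: probability_le1.
Qed.

Lemma measurable_Phi : measurable_fun [set: R] (@Phi R).
Proof.
apply: nondecreasing_measurable => // x z xz.
rewrite /Phi fine_le ?fin_num_measure// le_measure ?inE//.
exact: subitvPr.
Qed.

Lemma tau_weight_ge0 beta tau : 0 <= tau_weight beta tau.
Proof.
rewrite /tau_weight mulr_ge0//; last by apply: prodr_ge0 => j _; exact: expR_ge0.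
have [t0|t0] := leP tau 0; first by rewrite density_le0// mul0r.
by rewrite mulr_ge0 ?density_ge0// invr_ge0 exprn_ge0// ltW.
Qed.

Lemma lambda_weight_ge0 betaj tau l : 0 <= lambda_weight betaj tau l.
Proof.
rewrite /lambda_weight; have [l0|l0] := leP l 0; first by rewrite density_le0// mulr0.
by rewrite !mulr_ge0 ?expR_ge0 ?density_ge0// invr_ge0 ltW.
Qed.

Lemma beta_weight_ge0 tau lambda beta : 0 <= beta_weight tau lambda beta.
Proof.
rewrite mulr_ge0//; apply: prodr_ge0 => i _; last exact: expR_ge0.
by rewrite mulr_ge0// exprn_ge0// ?Phi_ge0// subr_ge0 Phi_le1.
Qed.

End gibbs_weights.

Section gibbs.
Context {R : realType} (n p : nat).
Local Notation RT := (measurableTypeR R).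
Local Notation vec := (p.-tuple RT).
(* Triples (beta, lambda, tau). *)
Local Notation state := (vec * vec * RT)%type.

Variables (X : 'M[R]_(n, p)) (y : 'I_n -> bool) (zeta a : R).
Variables (pi_loc pi_glo : density R).

Definition state_space : set state :=
  [set s | (forall j, (0 : R) < tnth s.1.2 j) /\ (0 : R) < s.2].

(* Along a transition from s0 = (beta0, lambda0, tau0) to (beta, lambda, tau), the
   draws are accumulated in the order (s0, tau, lambda, beta). *)
Definition tau_density (z : state * RT) : R := tau_weight a pi_glo z.1.1.1 z.2.

Definition lambda_density (j : 'I_p) (z : state * RT * RT) : R :=
  lambda_weight pi_loc (tnth z.1.1.1.1 j) z.1.2 z.2.

Definition beta_density (z : state * RT * vec * vec) : R :=
  beta_weight X y zeta z.1.1.2 z.1.2 z.2.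

Definition new_state (z : state * RT * vec * vec) : state := (z.2, z.1.2, z.1.1.2).

Lemma measurable_coord d (T : measurableType d) (f : T -> vec) (j : 'I_p) :
  measurable_fun setT f -> measurable_fun setT (fun z => tnth (f z) j : R).
Proof. move=> mf; exact: (measurableT_comp (measurable_tnth j) mf). Qed.

Lemma measurable_inv_comp d (T : measurableType d) (f : T -> R) :
  measurable_fun setT f -> measurable_fun setT (fun z => (f z)^-1).
Proof. by move=> mf; exact: (measurableT_comp measurable_invr mf). Qed.

Lemma measurable_expR_comp d (T : measurableType d) (f : T -> R) :
  measurable_fun setT f -> measurable_fun setT (fun z => expR (f z)).
Proof. by move=> mf; exact: (measurableT_comp (@measurable_expR R) mf). Qed.

Lemma measurable_tau_density : measurable_fun setT tau_density.
Proof.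
have m2 : measurable_fun setT (fun z : state * RT => z.2 : R) by exact: measurable_snd.
have m1 : measurable_fun setT (fun z : state * RT => z.1.1.1).
  exact: (measurableT_comp measurable_fst (measurableT_comp measurable_fst measurable_fst)).
apply: measurable_funM; [apply: measurable_funM|apply: measurable_prod => j _].
- exact: (measurableT_comp (measurable_density pi_glo) m2).
- by apply: measurable_inv_comp; exact: measurable_funX.
- apply: measurable_expR_comp; apply: measurable_funN.
  apply: (measurableT_comp (@measurable_powR R a)).
  apply: (measurableT_comp (@normr_measurable R setT)).
  by apply: measurable_funM; [exact: measurable_coord|exact: measurable_inv_comp].
Qed.

Lemma measurable_lambda_density j : measurable_fun setT (lambda_density j).
Proof.
have ml : measurable_fun setT (fun z : state * RT * RT => z.2 : R) by exact: measurable_snd.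
have mt : measurable_fun setT (fun z : state * RT * RT => z.1.2 : R).
  exact: (measurableT_comp measurable_snd measurable_fst).
have mb : measurable_fun setT (fun z : state * RT * RT => z.1.1.1.1).
  exact: (measurableT_comp measurable_fst (measurableT_comp measurable_fst
    (measurableT_comp measurable_fst measurable_fst))).
apply: measurable_funM; [apply: measurable_funM|].
- exact: measurable_inv_comp.
- apply: measurable_expR_comp; apply: measurable_funN; apply: measurable_funM.
    by apply: measurable_funX; exact: measurable_coord.
  apply: measurable_inv_comp; apply: measurable_funM; last exact: measurable_funX.
  by apply: measurable_funM => //; exact: measurable_funX.
- exact: (measurableT_comp (measurable_density pi_loc) ml).
Qed.

Lemma measurable_beta_density : measurable_fun setT beta_density.
Proof.
have mb : measurable_fun setT (fun z : state * RT * vec * vec => z.2).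
  exact: measurable_snd.
have ml : measurable_fun setT (fun z : state * RT * vec * vec => z.1.2).
  exact: (measurableT_comp measurable_snd measurable_fst).
have mt : measurable_fun setT (fun z : state * RT * vec * vec => z.1.1.2 : R).
  exact: (measurableT_comp measurable_snd (measurableT_comp measurable_fst measurable_fst)).
apply: measurable_funM; apply: measurable_prod => i _.
- have mP : measurable_fun setT
      (fun z : state * RT * vec * vec => Phi (predictor X z.2 i)).
    apply: (measurableT_comp (@measurable_Phi R)); apply: measurable_sum => j.
    by apply: measurable_funM => //; exact: measurable_coord.
  apply: measurable_funM; apply: measurable_funX => //.
  exact: measurable_funB.
- apply: measurable_expR_comp; apply: measurable_funN; apply: measurable_funM; last first.
    by apply: measurable_funX; exact: measurable_coord.
  apply: measurable_funM => //; apply: measurable_funD => //.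
  apply: measurable_funM; apply: measurable_inv_comp; apply: measurable_funX => //.
  exact: measurable_coord.
Qed.

Lemma measurable_new_state : measurable_fun setT new_state.
Proof.
apply: measurable_fun_pair; [apply: measurable_fun_pair|].
- exact: measurable_snd.
- exact: (measurableT_comp measurable_snd measurable_fst).
- exact: (measurableT_comp measurable_snd (measurableT_comp measurable_fst measurable_fst)).
Qed.

Definition tau_draw : R.-pker state ~> RT :=
  kdraw (@lebesgue_measure R) measurable_tau_density
    (fun z => tau_weight_ge0 a pi_glo _ _) (0 : R).

Definition lambda_draw : R.-pker (state * RT) ~> vec :=
  kindep (fun j => kdraw (@lebesgue_measure R) (measurable_lambda_density j)
    (fun z => lambda_weight_ge0 pi_loc _ _ _) (0 : R)).

Definition beta_draw : R.-pker (state * RT * vec) ~> vec :=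
  kdraw (@lebesgue_tuple R p) measurable_beta_density
    (fun z => beta_weight_ge0 X y zeta _ _ _) [tuple of nseq p (0 : R)].

Definition gibbs : R.-pker state ~> state :=
  kbind tau_draw (kbind lambda_draw (kbind beta_draw (kdirac measurable_new_state))).

End gibbs.

(* Main.v *)
Require Import Defs.
From HB Require Import structures.
From mathcomp Require Import all_boot all_order all_algebra.
From mathcomp Require Import all_classical all_reals all_analysis.
From mathcomp Require Import measurable_realfun.
From mathcomp Require Import ring lra.

Set Implicit Arguments.
Unset Strict Implicit.
Unset Printing Implicit Defensive.
Import Order.TTheory GRing.Theory Num.Theory.
Import numFieldNormedType.Exports.

Local Open Scope classical_set_scope.
Local Open Scope ring_scope.

(* The law of one transition from (beta, lambda, tau) depends on beta only, so it
   suffices to bound below the law of the new beta.  A Doeblin minorization for the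
   new beta alone gives a contraction of the oscillation of x |-> P^k x A, hence a
   limit law that is independent of x and approached at a uniform geometric rate.

   The minorization has three ingredients.  Since pi_glo vanishes below tau_min, the
   drawn tau is at least tau_min.  Given tau, the weight of lambda_j is
   exp (- s / l^2) l^-1 pi_loc l with s >= 0, and the exponential is increasing in l,
   so P(lambda_j >= delta) is at least its value at s = 0, provided l^-1 pi_loc l is
   integrable; the substitution u = l^-2 / 2 turns that integral near 0 into an
   integral of the stable density.  Finally, when tau >= tau_min and
   lambda_j >= delta, the weight of the new beta lies between its value at
   (tau_min, delta) and the centred Gaussian weight of variance zeta^2, whatever the
   starting point. *)

(** * Doeblin's theorem *)

Section mean_value.
Context d (T : measurableType d) (R : realType).

(** Moves means from extended to real numbers, so that later comparisons are linear arithmetic. The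
    functions [g], [g - a] and [b - g] are all nonnegative, so additivity of nonnegative integrals
    suffices. *)
Lemma probability_mean (mu : {measure set T -> \bar R}) (g : T -> R) (a b : R) :
  mu setT = 1%E ->
  measurable_fun setT g -> 0 <= a -> (forall y, a <= g y <= b) ->
  exists I : R, [/\ (\int[mu]_y (g y)%:E = I%:E)%E,
    (\int[mu]_y (g y - a)%:E = (I - a)%:E)%E &
    (\int[mu]_y (b - g y)%:E = (b - I)%:E)%E].
Proof.
move=> mu1 mg a0 gab.
have g0 y : 0 <= g y by have /andP[ag _] := gab y; exact: le_trans ag.
have mE (f : T -> R) : measurable_fun setT f -> measurable_fun setT (EFin \o f).
  by move=> mf; exact/measurable_EFinP.
have cstE (c : R) : (\int[mu]_y (cst c%:E y) = c%:E)%E.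
  by rewrite integral_cst// mu1 mule1.
have sumb : (\int[mu]_y (b - g y)%:E + \int[mu]_y (g y)%:E = b%:E)%E.
  rewrite -ge0_integralD//.
  - by rewrite -[RHS](cstE b); apply: eq_integral => y _; rewrite -EFinD subrK.
  - by move=> y _; rewrite lee_fin subr_ge0; case/andP: (gab y).
  - by apply: mE; exact: measurable_funB.
  - by move=> y _; rewrite lee_fin.
  - exact: mE.
have suma : (\int[mu]_y (g y - a)%:E + a%:E = \int[mu]_y (g y)%:E)%E.
  rewrite -[X in (_ + X)%E](cstE a) -ge0_integralD//.
  - by apply: eq_integral => y _; rewrite -EFinD subrK.
  - by move=> y _; rewrite lee_fin subr_ge0; case/andP: (gab y).
  - by apply: mE; exact: measurable_funB.
have Ib0 : (0 <= \int[mu]_y (b - g y)%:E)%E.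
  by apply: integral_ge0 => y _; rewrite lee_fin subr_ge0; case/andP: (gab y).
have Ig0 : (0 <= \int[mu]_y (g y)%:E)%E.
  by apply: integral_ge0 => y _; rewrite lee_fin.
move: Ib0 Ig0 sumb suma.
(* Two nonnegative integrals with the finite sum [b] are both finite. *)
case: (integral mu setT (fun y => (b - g y)%:E)) => [s| |] // _; last by case: (integral _ _ _).
case: (integral mu setT (fun y => (g y)%:E)) => [I| |] // _.
move=> -[sI]; exists I; split => //; last by rewrite -sI addrK.
by move: suma; case: (integral _ _ _) => // r -[<-]; rewrite addrK.
Qed.

Lemma probability_mean_bounds (mu : {measure set T -> \bar R}) (g : T -> R) (a b : R) :
  mu setT = 1%E ->
  measurable_fun setT g -> 0 <= a -> (forall y, a <= g y <= b) ->
  (a%:E <= \int[mu]_y (g y)%:E <= b%:E)%E.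
Proof.
move=> mu1 mg a0 gab; have [I [-> Ia Ib]] := probability_mean mu1 mg a0 gab.
rewrite !lee_fin -(subr_ge0 a) -(subr_ge0 I b) -!lee_fin -Ia -Ib.
by apply/andP; split; apply: integral_ge0 => y _; rewrite lee_fin subr_ge0;
  case/andP: (gab y).
Qed.

End mean_value.

(** * Iterates of a Markov kernel *)

Section kernel_powers.
Context d (T : measurableType d) (R : realType) (P : R.-pker T ~> T).

(** [kstep] is a bare set function; building the same iterates from [kbind] makes them probability
    kernels, with measurability and additivity included. *)
Fixpoint kpow (k : nat) : R.-pker T ~> T :=
  if k is k'.+1 then kbind P (kpre (kpow k') measurable_snd)
  else kdirac (@measurable_id _ T setT).

Lemma kpowS k x A : kpow k.+1 x A = (\int[P x]_y kpow k y A)%E.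
Proof. by []. Qed.

Lemma kstepE k x A : kstep P k x A = kpow k x A.
Proof.
elim: k x => [//|k IHk] x; rewrite kpowS /=.
by apply: eq_integral => y _; exact: IHk.
Qed.

(** The recursion defining [kpow] takes the new transition first. Taking it last is what links the
    limit law to stationarity. *)
Lemma kpowSr k x A : measurable A ->
  kpow k.+1 x A = (\int[kpow k x]_y P y A)%E.
Proof.
move=> mA; have mPA : measurable_fun setT (fun y => P y A) by exact: measurable_kernel.
elim: k x => [|k IHk] x.
  rewrite kpowS /= integral_dirac// diracT mul1e.
  transitivity (\int[P x]_y (\1_A y)%:E)%E; last by rewrite integral_indic// setIT.
  by apply: eq_integral => y _; rewrite diracE indicE.
rewrite kpowS (eq_integral (fun y => \int[kpow k y]_z P z A)%E); last first.
  by move=> y _; exact: IHk.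
by rewrite [in RHS]/kpow /= [RHS]integral_kcomp.
Qed.

Definition rkpow k A x : R := fine (kpow k x A).

Lemma rkpowE k A x : measurable A -> kpow k x A = (rkpow k A x)%:E.
Proof.
move=> mA; rewrite /rkpow fineK// ge0_fin_numE// (@le_lt_trans _ _ 1%E) ?ltry//.
by rewrite -(@prob_kernel _ _ _ _ _ (kpow k) x) le_measure ?inE.
Qed.

Lemma measurable_rkpow k A : measurable A -> measurable_fun setT (rkpow k A).
Proof. by move=> mA; apply/measurable_EFinP; rewrite (_ : EFin \o _ = fun x => kpow k x A);
  [exact: measurable_kernel|apply/funext => x /=; rewrite rkpowE]. Qed.

Lemma rkpow_ge0 k A x : 0 <= rkpow k A x.
Proof. exact: fine_ge0. Qed.

Lemma rkpow_le1 k A x : measurable A -> rkpow k A x <= 1.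
Proof. by move=> mA; rewrite -lee_fin -rkpowE// -(@prob_kernel _ _ _ _ _ (kpow k) x) le_measure ?inE. Qed.

End kernel_powers.

Section doeblin.
Context d (T : measurableType d) (R : realType) (P : R.-pker T ~> T).
(* A transition depends on its starting point x only through r x, and only the law of
   r of the new state is minorized. *)
Variables (r : T -> T) (nu : {measure set T -> \bar R}) (eps : R).
Hypotheses (mr : measurable_fun setT r) (nu1 : nu setT = 1%E).
Hypotheses (eps_gt0 : 0 < eps) (eps_lt1 : eps < 1).
Hypothesis Pr : forall x A, measurable A -> P (r x) A = P x A.
Hypothesis minor :
  forall x A, measurable A -> (eps%:E * nu A <= P x (r @^-1` A))%E.

Local Notation u := (rkpow P).

(** A function invariant under [r] has the same integral against [P x] as against the pushforward of
    [P x] by [r], and that pushforward dominates [eps * nu] on every measurable set. *)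
Let minor_integral x (g : T -> R) : measurable_fun setT g -> (forall y, 0 <= g y) ->
  (forall y, g (r y) = g y) ->
  (eps%:E * \int[nu]_y (g y)%:E <= \int[P x]_y (g y)%:E)%E.
Proof.
move=> mg g0 gr.
have mgE : measurable_fun setT (fun y => (g y)%:E) by exact/measurable_EFinP.
pose e : {nonneg R} := NngNum (ltW eps_gt0).
rewrite [leRHS](_ : _ = \int[pushforward (P x) r]_y (g y)%:E)%E; last first.
  rewrite ge0_integral_pushforward// ?preimage_setT; first by apply: eq_integral => y _ /=; rewrite gr.
  by move=> y _; rewrite lee_fin.
rewrite -[X in (X * _)%E]/(e%:num%:E) -ge0_integral_mscale//; last first.
  by move=> y _; rewrite lee_fin.
pose pf : {measure set T -> \bar R} :=
  measure_function_pushforward__canonical__measure_function_Measure (P x) mr.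
apply: (@ge0_le_measure_integral _ _ _ (mscale e nu) pf) => // A mA.
exact: minor.
Qed.

(** The index starts at 1 because [u 0 A] is the indicator of [A], which need not be invariant under
    [r]. *)
Let u_r k A y : measurable A -> u k.+1 A (r y) = u k.+1 A y.
Proof.
move=> mA; rewrite /rkpow !kpowS; congr fine.
by apply: eq_measure_integral => B mB _; exact: Pr.
Qed.

(** Suppose [g = u k.+1 A] has values in [[a, a + e]] and mean [J] under [nu]. Minorizing the
    integrals of [g - a] and of [a + e - g] confines every mean of [g] under [P x] to the interval
    from [a + eps * (J - a)] to [a + e - eps * (a + e - J)], whose length is [(1 - eps) * e]. *)
Let contraction k A : measurable A -> exists a : R, 0 <= a /\
  forall x, a <= u k.+1 A x <= a + (1 - eps) ^+ k.
Proof.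
move=> mA; elim: k => [|k [a [a0 IHk]]].
  by exists 0; split => // x; rewrite rkpow_ge0 add0r expr0 rkpow_le1.
set e := (1 - eps) ^+ k in IHk *; set g := u k.+1 A in IHk *.
have mg : measurable_fun setT g by exact: measurable_rkpow.
have [J [_ Ja Jb]] := probability_mean nu1 mg a0 IHk.
have aJ : 0 <= J - a.
  by rewrite -lee_fin -Ja; apply: integral_ge0 => y _; rewrite lee_fin subr_ge0; case/andP: (IHk y).
exists (a + eps * (J - a)); split; first by rewrite addr_ge0// mulr_ge0// ltW.
move=> x; have [I [Ig Ia Ib]] := probability_mean (@prob_kernel _ _ _ _ _ P x) mg a0 IHk.
have -> : u k.+2 A x = I.
  apply: EFin_inj; rewrite -rkpowE// kpowS -Ig; apply: eq_integral => y _.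
  by rewrite rkpowE.
have gr y : g (r y) = g y by exact: u_r.
have h1 : eps * (J - a) <= I - a.
  rewrite -lee_fin EFinM -Ja -Ia; apply: minor_integral => [|y|y].
  - exact: measurable_funB.
  - by rewrite subr_ge0; case/andP: (IHk y).
  - by rewrite gr.
have h2 : eps * (a + e - J) <= a + e - I.
  rewrite -lee_fin EFinM -Jb -Ib; apply: minor_integral => [|y|y].
  - exact: measurable_funB.
  - by rewrite subr_ge0; case/andP: (IHk y).
  - by rewrite gr.
rewrite exprS -/e; apply/andP; split; lra.
Qed.

(** Averaging against [P x] keeps values inside any interval that contains them, so the bounds
    reached at time [k.+1] persist at all later times. *)
Let contraction_all k A : measurable A -> exists a : R, 0 <= a /\
  forall l x, a <= u (l + k.+1) A x <= a + (1 - eps) ^+ k.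
Proof.
move=> mA; have [a [a0 ka]] := contraction k mA.
exists a; split => //; elim=> [|l IHl] x; first exact: ka.
have mg : measurable_fun setT (u (l + k.+1) A) by exact: measurable_rkpow.
have := probability_mean_bounds (@prob_kernel _ _ _ _ _ P x) mg a0 IHl.
rewrite [integral _ _ _](_ : _ = (u (l.+1 + k.+1) A x)%:E) ?lee_fin//.
rewrite -rkpowE// addSn kpowS; apply: eq_integral => y _.
by rewrite rkpowE.
Qed.

(* The oscillation of u k A tends to 0, so the supremum of the eventual lower bounds
   is the common limit of all the u k A x. *)
Let lower A : set R := [set a | exists N, forall n x, (N <= n)%N -> a <= u n A x].

Let lim_law A : R := sup (lower A).

Let lower0 A : lower A 0.
Proof. by exists 0%N => n x _; exact: rkpow_ge0. Qed.

Let lower_ub k A a : measurable A ->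
  (forall l x, u (l + k.+1) A x <= a) -> ubound (lower A) a.
Proof.
move=> mA ka b [N bN]; apply: (le_trans (bN (N + k.+1)%N point _)); last exact: ka.
by rewrite leq_addr.
Qed.

(** Both numbers lie in the same interval [[a, a + (1 - eps) ^+ k]]. The bound is uniform in [A] as
    well as in [x], which countable additivity of the limit needs. *)
Let lim_law_near k A l x : measurable A ->
  `|u (l + k.+1) A x - lim_law A| <= (1 - eps) ^+ k.
Proof.
move=> mA; have [a [a0 ka]] := contraction_all k mA.
have /andP[au ua] := ka l x.
have kub m z : u (m + k.+1) A z <= a + (1 - eps) ^+ k by case/andP: (ka m z).
have ub := lower_ub mA kub.
have aL : a <= lim_law A.
  have hs : has_sup (lower A) := conj (ex_intro _ 0 (lower0 A)) (ex_intro _ _ ub).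
  apply: (sup_upper_bound hs).
  exists k.+1 => n z kn; rewrite -(subnK kn).
  by case/andP: (ka (n - k.+1)%N z).
have La : lim_law A <= a + (1 - eps) ^+ k.
  by apply: ge_sup => //; exists 0; exact: lower0.
by rewrite ler_norml; apply/andP; split; lra.
Qed.

Let rho01 : 0 <= 1 - eps /\ 1 - eps < 1.
Proof. by split; move: eps_gt0 eps_lt1; lra. Qed.

Let cvg_rho : (1 - eps) ^+ k @[k --> \oo] --> (0 : R).
Proof. by apply: cvg_expr; rewrite ger0_norm; case: rho01. Qed.

Let lim_law_cvg A x : measurable A -> u k A x @[k --> \oo] --> lim_law A.
Proof.
move=> mA; rewrite -(cvg_shiftS (fun k => u k A x)) /=.
apply/cvgrPdist_le => e e0.
near=> k; rewrite distrC (le_trans (@lim_law_near k A 0 x mA))//.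
rewrite -[leLHS]ger0_norm ?exprn_ge0//; last by case: rho01.
rewrite -[_ ^+ k]subr0 distrC.
by near: k; move/cvgrPdist_le: cvg_rho => /(_ e e0).
Unshelve. all: by end_near. Qed.

(** Evaluates the limit law from the iterates at a single starting point; below that point is
    [point]. *)
Let lim_law_unique A (c : R) x : measurable A ->
  u k A x @[k --> \oo] --> c -> lim_law A = c.
Proof. by move=> mA uc; apply: (cvg_unique _ (@lim_law_cvg A x mA) uc). Qed.

Definition limit_law (A : set T) : \bar R := (lim_law A)%:E.

Let limit_law0 : limit_law set0 = 0%E.
Proof.
congr EFin; apply: (@lim_law_unique _ _ point) => //.
rewrite (_ : (fun k => _) = cst 0); first exact: cvg_cst.
by apply/funext => k; rewrite /rkpow measure0.
Qed.

Let limit_law_ge0 A : (0 <= limit_law A)%E.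
Proof.
(* Here [A] may be non-measurable; if [lower A] has no supremum, [sup] takes its default value 0. *)
rewrite lee_fin; have [h|h] := pselect (has_sup (lower A)).
  exact: (sup_upper_bound h (lower0 A)).
by rewrite /lim_law sup_out.
Qed.

(** Finite additivity passes to the limit. Countable additivity is a three-term estimate: fix [k]
    with [(1 - eps) ^+ k <= e / 3], which controls the distance to [u k.+1] for all sets at once,
    then use the countable additivity of the measure [kpow P k.+1 point]. *)
Let limit_law_sigma_additive : semi_sigma_additive limit_law.
Proof.
move=> F mF tF mUF.
have fin_add n : (\sum_(0 <= i < n) limit_law (F i) = (lim_law (\big[setU/set0]_(i < n) F i))%:E)%E.
  rewrite /limit_law sumEFin; congr EFin; apply/esym.
  have mFn : measurable (\big[setU/set0]_(i < n) F i) by exact: bigsetU_measurable.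
  apply: (@lim_law_unique _ _ point) => //.
  rewrite (_ : (fun k => _) = (fun k => \sum_(0 <= i < n) u k (F i) point)).
    apply: cvg_big => [|i _]; [exact: add_continuous|exact: lim_law_cvg].
  apply/funext => k; apply: EFin_inj; rewrite -rkpowE// -sumEFin.
  rewrite measure_bigsetU// big_mkord.
  by apply: eq_bigr => i _; exact: rkpowE.
under eq_fun do rewrite fin_add.
apply: cvg_EFin; first by near=> n.
apply/cvgrPdist_le => e e0 /=.
have e3 : 0 < e / 3 by rewrite divr_gt0.
have [k _ ke] : \forall k \near \oo, (1 - eps) ^+ k <= e / 3.
  move/cvgrPdist_le : cvg_rho => /(_ _ e3); apply: filterS => k.
  by rewrite sub0r normrN; apply: le_trans; exact: ler_norm.
have {}ke := ke k (leqnn k).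
have cvgu : u k.+1 (\big[setU/set0]_(i < n) F i) point @[n --> \oo] --> u k.+1 (\bigcup_i F i) point.
  have := @measure_semi_sigma_additive _ _ _ (kpow P k.+1 point) F mF tF mUF.
  rewrite (rkpowE P k.+1 point mUF) => /fine_cvg.
  rewrite (_ : fine \o _ = fun n => u k.+1 (\big[setU/set0]_(i < n) F i) point)//.
  apply/funext => n /=; rewrite big_mkord /rkpow; congr fine.
  by rewrite measure_bigsetU// big_mkord.
have mFn n : measurable (\big[setU/set0]_(i < n) F i) by exact: bigsetU_measurable.
near=> n.
have h1 := @lim_law_near k (\bigcup_i F i) 0 point mUF.
have h2 := @lim_law_near k (\big[setU/set0]_(i < n) F i) 0 point (mFn n).
have h3 : `|u k.+1 (\bigcup_i F i) point - u k.+1 (\big[setU/set0]_(i < n) F i) point| <= e / 3.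
  by near: n; move/cvgrPdist_le: cvgu => /(_ _ e3).
move: h1 h2 h3; rewrite !ler_norml => /andP[h1 h2] /andP[h3 h4] /andP[h5 h6].
by move: ke h1 h2 h3 h4 h5 h6; rewrite !add0n => *; apply/andP; split; lra.
Unshelve. all: by end_near. Qed.

HB.instance Definition _ := isMeasure.Build _ _ _ limit_law
  limit_law0 limit_law_ge0 limit_law_sigma_additive.

Let limit_law_setT : limit_law setT = 1%E.
Proof.
congr EFin; apply: (@lim_law_unique _ _ point) => //.
rewrite (_ : (fun k => _) = cst 1); first exact: cvg_cst.
by apply/funext => k; rewrite /rkpow prob_kernel.
Qed.

HB.instance Definition _ := Measure_isProbability.Build _ _ _ limit_law limit_law_setT.

Import HBNNSimple.

(** The integral is a supremum over simple functions [h] below [P ^~ A]. The integral of such an [h]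
    against the limit law is the limit of its integrals against [kpow P k point], each at most
    [u k.+1 A point] by [kpowSr], and these converge to [lim_law A]. *)
Let stationary_le A : measurable A -> (\int[limit_law]_x P x A <= limit_law A)%E.
Proof.
move=> mA; rewrite ge0_integralTE//; apply: ge_ereal_sup => _ [h hP <-].
have simple (m : {measure set T -> \bar R}) (v : set T -> R) :
    (forall B, measurable B -> m B = (v B)%:E) ->
    sintegral m h = (\sum_(c <- finmap.enum_fset (fset_set (range h))) c * v (h @^-1` [set c]))%:E.
  move=> mv; rewrite sintegralE fsbig_finite//= -sumEFin.
  by apply: eq_bigr => c _; rewrite mv.
rewrite (simple _ lim_law)// lee_fin.
have E1 : \sum_(c <- finmap.enum_fset (fset_set (range h))) c * u k (h @^-1` [set c]) point
    @[k --> \oo] --> \sum_(c <- finmap.enum_fset (fset_set (range h))) c * lim_law (h @^-1` [set c]).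
  apply: cvg_big => [|c _]; first exact: add_continuous.
  by apply: cvgMr; exact: lim_law_cvg.
have E2 : u k.+1 A point @[k --> \oo] --> lim_law A.
  by rewrite (cvg_shiftS (fun k => u k A point)); exact: lim_law_cvg.
apply: (ler_cvg_to E1 E2).
apply: nearW => k; rewrite -lee_fin -(simple (kpow P k point) (fun B => u k B point)); last first.
  by move=> B mB; rewrite rkpowE.
rewrite -rkpowE// kpowSr// -integralT_nnsfun.
apply: ge0_le_integral => //.
- by move=> x _; rewrite lee_fin.
- exact/measurable_EFinP.
- exact: measurable_kernel.
Qed.

(** The inequality for [A] and for its complement forces equality, since each side sums to 1 over
    the two sets. *)
Let limit_law_stationary : stationary P limit_law.
Proof.
move=> A mA; apply/eqP; rewrite eq_le stationary_le//=.
have mAC : measurable (~` A) by exact: measurableC.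
have mP B : measurable B -> measurable_fun setT (P ^~ B) by exact: measurable_kernel.
have PAC x : (P x A + P x (~` A) = 1)%E.
  by rewrite -measureU ?setICr// setUCr; exact: prob_kernel.
have sumI : (\int[limit_law]_x P x A + \int[limit_law]_x P x (~` A) = 1)%E.
  rewrite -ge0_integralD//; [|exact: mP|exact: mP].
  rewrite (eq_integral (cst 1%E)); last by move=> x _; exact: PAC.
  by rewrite integral_cst// mul1e; exact: limit_law_setT.
have sumL : (limit_law A + limit_law (~` A) = 1)%E.
  by rewrite -measureU ?setICr// setUCr; exact: limit_law_setT.
have I0 B : (0 <= \int[limit_law]_x P x B)%E by exact: integral_ge0.
move: sumI sumL (stationary_le mAC) (I0 A) (I0 (~` A)); rewrite /limit_law.
case: (integral _ _ _) => [a| |]//; case: (integral _ _ _) => [b| |]//.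
by rewrite -!EFinD !lee_fin => -[ab1] -[LL1] *; lra.
Qed.

Theorem doeblin (S : set T) : measurable S -> (forall x, P x S = 1%E) ->
  uniformly_ergodic S P.
Proof.
move=> mS PS; exists limit_law; split => //.
  rewrite -limit_law_stationary//.
  rewrite (eq_integral (cst 1%E)); last by move=> x _; exact: PS.
  by rewrite integral_cst// mul1e; exact: limit_law_setT.
have r0 : 0 < 1 - eps by rewrite subr_gt0.
(* The bound at time [k.+1] is [(1 - eps) ^+ k]; the factor [(1 - eps)^-1] absorbs this shift and,
   being at least 1, covers time 0. *)
exists (1 - eps)^-1, (1 - eps); split; [exact: ltW|by case: rho01|].
move=> x k _; apply: ge_ereal_sup => _ [A mA <-].
rewrite kstepE rkpowE// /limit_law -EFinB abse_EFin lee_fin.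
case: k => [|k].
  rewrite expr0 mulr1; apply: (@le_trans _ _ 1); last first.
    by rewrite invf_ge1//; move: eps_gt0; lra.
  have L0 : 0 <= lim_law A by rewrite -lee_fin; exact: limit_law_ge0.
  have L1 : lim_law A <= 1 by rewrite -lee_fin -limit_law_setT; exact: (@le_measure _ _ _ limit_law _ _ (mem_set mA) (mem_set measurableT)).
  have := rkpow_ge0 P 0 A x; have := rkpow_le1 P 0 x mA.
  by move: L0 L1 => ? ? ? ?; rewrite ler_norml; apply/andP; split; lra.
by rewrite exprS mulKf ?gt_eqF//; exact: (@lim_law_near k A 0 x mA).
Qed.

End doeblin.

(** * Composition and normalization of kernels *)

Section kernel_bounds.
Context {R : realType}.

(** Applied repeatedly along nested draws, this multiplies the lower bounds of the individual
    draws. *)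
Lemma kbind_ge d d' d'' (X : measurableType d) (Y : measurableType d')
    (Z : measurableType d'') (l : R.-pker X ~> Y) (k : R.-pker (X * Y) ~> Z)
    (x : X) (B : set Y) (A : set Z) (a b : R) :
  measurable B -> measurable A -> 0 <= b -> (a%:E <= l x B)%E ->
  (forall v, B v -> (b%:E <= k (x, v) A)%E) ->
  ((b * a)%:E <= kbind l k x A)%E.
Proof.
move=> mB mA b0 aB bk.
have mk : measurable_fun setT (fun v => k (x, v) A).
  exact: (measurableT_comp (measurable_kernel k A mA) (pair1_measurable x)).
apply: (@le_trans _ _ (\int[l x]_(v in B) k (x, v) A)%E); last first.
  by apply: ge0_subset_integral.
apply: (@le_trans _ _ (\int[l x]_(v in B) (cst b%:E v))%E); last first.
  apply: ge0_le_integral => //; first exact: measurable_funTS.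
rewrite integral_cst// EFinM lee_wpmul2l//.
Qed.

Lemma kbind_eq d d' d'' (X : measurableType d) (Y : measurableType d')
    (Z : measurableType d'') (l : R.-pker X ~> Y) (k : R.-pker (X * Y) ~> Z)
    (x x' : X) :
  (forall U, measurable U -> l x U = l x' U) ->
  (forall v U, measurable U -> k (x, v) U = k (x', v) U) ->
  forall U, measurable U -> kbind l k x U = kbind l k x' U.
Proof.
move=> lxx' kxx' U mU; rewrite /kbind /=.
transitivity (\int[l x]_v k (x', v) U)%E.
  by apply: eq_integral => v _; exact: kxx'.
by apply: eq_measure_integral => A mA _; exact: lxx'.
Qed.

Context d d' (X : measurableType d) (Y : measurableType d').

Lemma measurable_forall_tnth (n : nat) (B : 'I_n -> set Y) :
  (forall i, measurable (B i)) ->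
  measurable [set t : n.-tuple Y | forall i, B i (tnth t i)].
Proof.
move=> mB; rewrite (_ : [set _ | _] = \bigcap_(i in [set: 'I_n]) ((@tnth n Y)^~ i @^-1` B i)).
  apply: fin_bigcap_measurable => // i _.
  by rewrite -[X in measurable X]setTI; exact: measurable_tnth.
by apply/seteqP; split => t /= tB i; [move=> _; exact: tB|exact: tB].
Qed.

Lemma kindepS (n : nat) (k : 'I_n.+1 -> R.-pker X ~> Y) :
  kindep k = kbind (k ord0)
    (kbind (kpre (kindep (fun i => k (lift ord0 i))) measurable_fst)
           (kdirac (@measurable_cons_step _ _ X Y n))).
Proof. by []. Qed.

Lemma kindep_ge (n : nat) (k : 'I_n -> R.-pker X ~> Y) (x : X) (B : set Y) (q : R) :
  measurable B -> 0 <= q -> (forall i, q%:E <= k i x B)%E ->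
  ((q ^+ n)%:E <= kindep k x [set t | forall i, B (tnth t i)])%E.
Proof.
move=> mB q0; elim: n k => [|n IHn] k kB.
  by rewrite /= diracE mem_set// => -[].
rewrite exprSr kindepS.
have mBn m : measurable [set t : m.-tuple Y | forall i, B (tnth t i)].
  exact: (@measurable_forall_tnth m (fun=> B)).
apply: (kbind_ge mB (mBn n.+1)) => //; first exact: exprn_ge0.
(* The factor 1 belongs to the deterministic step that prepends [v] to the tuple. *)
move=> v Bv; rewrite -[q ^+ n]mul1r.
apply: (kbind_ge (mBn n) (mBn n.+1)) => //; first by apply: IHn => i; exact: kB.
move=> t tB; rewrite /= diracE mem_set// => i.
by case: (unliftP ord0 i) => [j|] ->; rewrite /cons_step /tuple_cons ?tnthS// tnth0.
Qed.

Lemma kindep_eq (n : nat) (k : 'I_n -> R.-pker X ~> Y) (x x' : X) :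
  (forall i U, measurable U -> k i x U = k i x' U) ->
  forall U, measurable U -> kindep k x U = kindep k x' U.
Proof.
elim: n k => [//|n IHn] k kxx' U mU; rewrite kindepS.
apply: kbind_eq => // [V mV|v V mV]; first exact: kxx'.
by apply: kbind_eq => // W mW; apply: IHn => // i; exact: kxx'.
Qed.

End kernel_bounds.

(** * Laws given by unnormalized densities *)

Section kdraw_theory.
Context {R : realType} d d' (X : measurableType d) (Y : measurableType d').
Variables (mu : {sigma_finite_measure set Y -> \bar R}) (f : X * Y -> R).
Variables (mf : measurable_fun [set: X * Y] f) (f0 : forall z, 0 <= f z) (y0 : Y).

Local Notation mass x := (\int[mu]_y (f (x, y))%:E)%E.
Local Notation draw := (kdraw mu mf f0 y0).

Lemma kdrawE x A : (0 < mass x)%E -> (mass x < +oo)%E ->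
  draw x A = ((\int[mu]_(y in A) (f (x, y))%:E) * (fine (mass x))^-1%:E)%E.
Proof.
move=> m0 moo; rewrite /kdraw /= /mnormalize /= /density_measure.
by rewrite ifF//; apply/negbTE; rewrite negb_or gt_eqF//= lt_eqF.
Qed.

(** The fallback point mass is covered too: equal total masses select the same branch. *)
Lemma kdraw_eq x x' : (forall y, f (x, y) = f (x', y)) -> forall U, draw x U = draw x' U.
Proof.
move=> fxx' U; rewrite /kdraw /= /mnormalize /= /density_measure.
have E A : (\int[mu]_(y in A) (f (x, y))%:E = \int[mu]_(y in A) (f (x', y))%:E)%E.
  by apply: eq_integral => y _; rewrite fxx'.
by rewrite !E; case: ifP => // _; rewrite E.
Qed.

Lemma kdraw_ge x A (q : R) : (0 < mass x)%E -> (mass x < +oo)%E ->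
  (q%:E * mass x <= \int[mu]_(y in A) (f (x, y))%:E)%E -> (q%:E <= draw x A)%E.
Proof.
move=> m0 moo qA; rewrite kdrawE//.
have /fineK mK : mass x \is a fin_num by rewrite ge0_fin_numE// ltW.
rewrite -mK in m0 qA *.
move: m0 qA; set m := fine _; rewrite lte_fin => m0 qA.
by rewrite lee_pdivlMr.
Qed.

Lemma kdraw_full x A : measurable A -> (0 < mass x)%E -> (mass x < +oo)%E ->
  (forall y, ~ A y -> f (x, y) = 0) -> (1%:E <= draw x A)%E.
Proof.
move=> mA m0 moo fA; apply: kdraw_ge => //; rewrite mul1e.
rewrite [leRHS]integral_mkcond le_eqVlt; apply/orP; left; apply/eqP.
apply: eq_integral => y _; rewrite patchE; case: ifPn => // /negP yA.
by rewrite fA// => Ay; apply: yA; rewrite inE.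
Qed.

(** The normalized density at [x] is at least [f (x', y) / C], which is the normalized density at
    [x'] times the ratio of the mass at [x'] to [C]. *)
Lemma kdraw_minorization x x' (C : R) A : measurable A -> 0 < C ->
  (0 < mass x')%E -> (mass x <= C%:E)%E -> (forall y, f (x', y) <= f (x, y)) ->
  ((fine (mass x') / C)%:E * draw x' A <= draw x A)%E.
Proof.
move=> mA C0 m0 mC ff.
have mfx z : measurable_fun setT (fun y => (f (z, y))%:E).
  by apply/measurable_EFinP; exact: measurable_fun_pair2.
have m'm : (mass x' <= mass x)%E.
  by apply: ge0_le_integral => // y _; rewrite ?lee_fin.
have moo : (mass x < +oo)%E by apply: le_lt_trans mC _; rewrite ltry.
have m'oo : (mass x' < +oo)%E by exact: le_lt_trans moo.
have m0x : (0 < mass x)%E by exact: lt_le_trans m'm.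
rewrite !kdrawE//.
have IA : (\int[mu]_(y in A) (f (x', y))%:E <= \int[mu]_(y in A) (f (x, y))%:E)%E.
  apply: ge0_le_integral => // [y _|||y _]; rewrite ?lee_fin//; exact: measurable_funTS.
have mpos z : (0 < mass z)%E -> (mass z < +oo)%E -> 0 < fine (mass z).
  by move=> z0 zoo; apply: fine_gt0; rewrite z0.
have m'p := mpos _ m0 m'oo; have mp := mpos _ m0x moo.
have mC' : fine (mass x) <= C by rewrite -lee_fin fineK// ge0_fin_numE// ltW.
rewrite muleCA -EFinM mulrAC divff ?mul1r ?gt_eqF//.
apply: lee_pmul => //; rewrite ?lee_fin ?invr_ge0 ?(ltW C0)//.
  by apply: integral_ge0 => y _; rewrite lee_fin.
by rewrite lef_pV2 ?posrE.
Qed.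

End kdraw_theory.

(** * Lebesgue integrals *)

Section positivity.
Context d (T : measurableType d) (R : realType) (m : {measure set T -> \bar R}).
Variables (D : set T) (mD : measurable D).

(** If the integral of [g * f] were 0, then [g * f], and hence [f], would vanish almost everywhere
    on [D]. *)
Lemma integral_mul_gt0 (f g : T -> R) :
  measurable_fun setT f -> measurable_fun setT g ->
  (forall x, D x -> 0 <= f x) -> (forall x, D x -> 0 < g x) ->
  (0 < \int[m]_(x in D) (f x)%:E)%E -> (0 < \int[m]_(x in D) (g x * f x)%:E)%E.
Proof.
move=> mf mg f0 g0 If; rewrite lt_neqAle eq_sym integral_ge0 ?andbT; last first.
  by move=> x Dx; rewrite lee_fin mulr_ge0 ?f0// ltW// g0.
apply: contraTneq If => gf0.
have mE (h : T -> R) : measurable_fun setT h -> measurable_fun D (EFin \o h).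
  by move=> mh; apply: measurable_funTS; exact/measurable_EFinP.
have mgf := mE _ (measurable_funM mg mf).
have /(ae_eq_integral_abs m mD mgf).1 gf_ae :
    (\int[m]_(x in D) `|(EFin \o (g \* f)%R) x| = 0)%E.
  rewrite -[RHS]gf0; apply: eq_integral => x /[!inE] Dx /=.
  by rewrite ger0_norm// mulr_ge0 ?f0// ltW// g0.
rewrite (_ : integral _ _ _ = 0%E) ?ltxx// -[RHS](integral0 m D).
apply: ae_eq_integral => //; first exact: mE.
apply: filterS gf_ae => x /= h Dx; have /eqP := h Dx.
by rewrite eqe mulf_eq0 gt_eqF ?g0//= => /eqP ->.
Qed.

Lemma integral_gt0 (f : T -> R) :
  measurable_fun setT f -> (forall x, D x -> 0 < f x) -> m D != 0%E ->
  (0 < \int[m]_(x in D) (f x)%:E)%E.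
Proof.
move=> mf f0 mD0; rewrite (eq_integral (fun x => (f x * cst 1 x)%:E)); last first.
  by move=> x _; rewrite mulr1.
apply: integral_mul_gt0 => //.
rewrite (eq_integral (cst 1%E))// integral_cst// mul1e.
by rewrite lt_neqAle eq_sym mD0 measure_ge0.
Qed.

End positivity.

(** * Lebesgue measure on tuples *)

Section lebesgue_tuple_theory.
Context {R : realType}.
Local Notation RT := (measurableTypeR R).
Local Notation mu := (@lebesgue_measure R).

Lemma lebesgue_tuple_setT_neq0 (n : nat) : @lebesgue_tuple R n setT != 0%E.
Proof.
elim: n => [|n IHn] /=; first by rewrite diracT.
rewrite /lebesgue_step /pushforward preimage_setT -setXTT product_measure1E//.
have leb : (mu setT = +oo)%E by rewrite -set_itvNyy lebesgue_measure_itv.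
by rewrite mule_neq0//; move: leb => /= ->.
Qed.

Lemma integral_lebesgue_step (n : nat) (m : {sigma_finite_measure set (n.-tuple RT) -> \bar R})
    (g : n.+1.-tuple RT -> \bar R) :
  measurable_fun setT g -> (forall t, 0 <= g t)%E ->
  (\int[lebesgue_step m]_t g t = \int[mu]_x \int[m]_t g (tuple_cons (x, t)))%E.
Proof.
move=> mg g0.
have mc : measurable_fun setT (@tuple_cons RT n) by exact: measurable_tuple_cons.
transitivity (\int[pushforward (mu \x m)%E (@tuple_cons RT n)]_t g t)%E.
  by apply: eq_measure_integral.
rewrite ge0_integral_pushforward// preimage_setT fubini_tonelli1//.
  exact: (measurableT_comp mg mc).
by move=> t; exact: g0.
Qed.

(** Tonelli's theorem, one coordinate at a time. It computes the mass of the Gaussian envelope of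
    the weight of beta. *)
Lemma integral_lebesgue_tuple_prod (n : nat) (f : R -> R) (c : R) :
  measurable_fun setT f -> (forall x, 0 <= f x) ->
  (\int[mu]_x (f x)%:E = c%:E)%E ->
  (\int[@lebesgue_tuple R n]_t (\prod_(j < n) f (tnth t j))%:E = (c ^+ n)%:E)%E.
Proof.
move=> mf f0 fc.
have mprod m : measurable_fun setT (fun t : m.-tuple RT => (\prod_(j < m) f (tnth t j))%:E).
  apply/measurable_EFinP; apply: measurable_prod => j _.
  exact: (measurableT_comp mf (measurable_tnth j)).
have p0 m (t : m.-tuple RT) : (0 <= (\prod_(j < m) f (tnth t j))%:E)%E.
  by rewrite lee_fin prodr_ge0.
elim: n => [|n IHn].
  rewrite integral_dirac//; last exact: (mprod 0%N).
  by rewrite diracT mul1e big_ord0 expr0.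
pose g (t : n.+1.-tuple RT) := (\prod_(j < n.+1) f (tnth t j))%:E.
rewrite [LHS](@integral_lebesgue_step n (lebesgue_tuple n) g)//; last exact: p0.
have gE x (t : n.-tuple RT) : g (tuple_cons (x, t)) =
    ((f x)%:E * (\prod_(j < n) f (tnth t j))%:E)%E.
  rewrite /g big_ord_recl /tuple_cons tnth0 EFinM; congr (_ * _%:E)%E.
  by apply: eq_bigr => j _; rewrite tnthS.
transitivity (\int[mu]_x ((c ^+ n)%:E * (f x)%:E))%E.
  apply: eq_integral => x _; under eq_integral do rewrite gE.
  rewrite ge0_integralZl_EFin//; last exact: mprod.
  by rewrite [RHS]muleC; congr (_ * _)%E; exact: IHn.
rewrite ge0_integralZl_EFin//; last 3 first.
- by move=> x _; rewrite lee_fin.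
- exact/measurable_EFinP.
- by rewrite -lee_fin -IHn; apply: integral_ge0.
by rewrite fc -EFinM exprSr.
Qed.

End lebesgue_tuple_theory.

(** * The Gaussian distribution function and the Gaussian integral *)

Section normal_cdf.
Context {R : realType}.

Lemma normal_pdf_gt0 (m s x : R) : s != 0 -> 0 < normal_pdf m s x.
Proof. by move=> s0; rewrite normal_pdfE// mulr_gt0 ?normal_peak_gt0// expR_gt0. Qed.

Lemma normal_prob_gt0 (m s : R) (D : set R) : s != 0 -> measurable D ->
  lebesgue_measure D != 0%E -> (0 < normal_prob m s D)%E.
Proof.
move=> s0 mD D0; apply: integral_gt0 => //; first exact: measurable_normal_pdf.
by move=> x _; exact: normal_pdf_gt0.
Qed.

Lemma Phi_gt0 (x : R) : 0 < Phi x.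
Proof.
rewrite /Phi fine_gt0// -ge0_fin_numE// fin_num_measure// andbT.
by apply: normal_prob_gt0 => //; rewrite lebesgue_measure_itv/= ltNyr.
Qed.

Lemma Phi_lt1 (x : R) : Phi x < 1.
Proof.
rewrite -lte_fin fineK ?fin_num_measure//.
have <- : (normal_prob 0 1 `]-oo, x] + normal_prob 0 1 `]x, +oo[ = 1)%E.
  rewrite -measureU//; last first.
    apply/seteqP; split => z //= []; rewrite !in_itv/= andbT => zx.
    by rewrite ltNge zx.
  by rewrite -[RHS](probability_setT (normal_prob 0 1)) -itv_bndbnd_setU// set_itvNyy.
rewrite lteDl ?fin_num_measure//.
by apply: normal_prob_gt0 => //; rewrite lebesgue_measure_itv/= ltry.
Qed.

Lemma integral_gauss (z : R) : 0 < z -> exists2 c : R, 0 < c &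
  (\int[@lebesgue_measure R]_x (expR (- (2^-1 * z ^- 2 * x ^+ 2)))%:E = c%:E)%E.
Proof.
move=> z0; have zn0 : z != 0 by rewrite gt_eqF.
have p0 := normal_peak_gt0 zn0.
(* The integrand is the normal density of mean 0 and standard deviation [z] divided by its peak
   value. *)
exists (normal_peak z)^-1; first by rewrite invr_gt0.
rewrite -[RHS]mule1 -(@integral_normal_pdf _ 0 z) -ge0_integralZl_EFin//.
- apply: eq_integral => x _; rewrite normal_pdfE// -EFinM mulKf ?gt_eqF//.
  rewrite /normal_fun subr0; congr (expR _)%:E.
  by field.
- by move=> x _; rewrite lee_fin normal_pdf_ge0.
- by apply/measurable_EFinP; exact: measurable_normal_pdf.
- by rewrite invr_ge0 ltW.
Qed.

End normal_cdf.

(** * Integration against a measure given by a density *)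

Section integral_kdensity.
Context d d' (X : measurableType d) (Y : measurableType d') (R : realType).
Variables (mu : {sigma_finite_measure set Y -> \bar R}) (f : X * Y -> R).
Hypotheses (mf : measurable_fun [set: X * Y] f) (f0 : forall z, 0 <= f z).

Import HBNNSimple.

Let mfx x : measurable_fun setT (fun y => (f (x, y))%:E).
Proof. by apply/measurable_EFinP; exact: measurable_fun_pair2. Qed.

Let integral_kdensity_nnsfun x (h : {nnsfun Y >-> R}) :
  (\int[kdensity mu mf f0 x]_y (h y)%:E = \int[mu]_y ((f (x, y))%:E * (h y)%:E))%E.
Proof.
transitivity (\sum_(r \in range h) \int[kdensity mu mf f0 x]_y (r * \1_(h @^-1` [set r]) y)%:E)%E.
  under eq_integral do rewrite fimfunE -fsumEFin//.
  rewrite ge0_integral_fsum//.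
  - by move=> r; exact/measurable_EFinP/measurableT_comp.
  - by move=> r z _; rewrite EFinM nnfun_muleindic_ge0.
transitivity (\sum_(r \in range h) \int[mu]_y ((f (x, y))%:E * (r * \1_(h @^-1` [set r]) y)%:E))%E; last first.
  rewrite -ge0_integral_fsum//.
  - apply: eq_integral => y _; rewrite [in RHS]fimfunE -fsumEFin// ge0_mule_fsumr//.
    by move=> r; rewrite EFinM nnfun_muleindic_ge0.
  - by move=> r; apply: emeasurable_funM => //; exact/measurable_EFinP/measurableT_comp.
  - by move=> r z _; apply: mule_ge0; [rewrite lee_fin|rewrite EFinM nnfun_muleindic_ge0].
apply: eq_fsbigr => r /[!inE] -[y _ hy].
have r0 : 0 <= r by rewrite -hy.
have mB : measurable (h @^-1` [set r]) by [].
under eq_integral do rewrite EFinM.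
rewrite ge0_integralZl_EFin//; last exact/measurable_EFinP.
rewrite [RHS](eq_integral (fun z => r%:E * ((f (x, z))%:E * (\1_(h @^-1` [set r]) z)%:E))%E); last first.
  by move=> z _; rewrite EFinM muleCA.
rewrite ge0_integralZl_EFin//; last 2 first.
- by move=> z _; rewrite mule_ge0 ?lee_fin.
- by apply: emeasurable_funM => //; exact/measurable_EFinP.
congr (_ * _)%E; rewrite integral_indic// setIT /kdensity /= /density_measure.
rewrite integral_mkcond; apply: eq_integral => z _.
by rewrite patchE indicE; case: ifPn => _; rewrite ?mule1 ?mule0.
Qed.

(** Monotone convergence from simple functions, where level sets reduce the claim to the definition
    of [density_measure]. *)
Lemma integral_kdensity x (g : Y -> \bar R) : measurable_fun setT g -> (forall y, 0 <= g y)%E ->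
  (\int[kdensity mu mf f0 x]_y g y = \int[mu]_y ((f (x, y))%:E * g y))%E.
Proof.
move=> mg g0; pose h := nnsfun_approx measurableT mg.
have hg y : ((h n y)%:E @[n --> \oo] --> g y)%E by exact: cvg_nnsfun_approx.
have ndh y a b : (a <= b)%N -> h a y <= h b y.
  by move=> ab; exact/lefP/nd_nnsfun_approx.
transitivity (\int[kdensity mu mf f0 x]_y lim ((h n y)%:E @[n --> \oo]))%E.
  by apply: eq_integral => y _; apply/esym/cvg_lim.
rewrite monotone_convergence//; last 3 first.
- by move=> n; exact/measurable_EFinP.
- by move=> n y _; rewrite lee_fin.
- by move=> y _ a b ab; rewrite lee_fin ndh.
under eq_fun do rewrite integral_kdensity_nnsfun.
rewrite -monotone_convergence//; last 3 first.
- by move=> n; apply: emeasurable_funM => //; exact/measurable_EFinP.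
- by move=> n y _; rewrite mule_ge0// lee_fin.
- by move=> y _ a b ab; rewrite lee_wpmul2l ?lee_fin// ndh.
apply: eq_integral => y _; apply/cvg_lim => //.
by apply: cvgeZl => //; exact: hg.
Qed.

End integral_kdensity.

(** * The substitution [u = x ^- 2 / 2] *)

Section change_of_variables.
Context {R : realType}.
Local Notation RT := (measurableTypeR R).
Local Notation mu := (@lebesgue_measure R).
Implicit Types (x u : R).

Definition half_invsq x : R := x ^- 2 / 2.

Lemma half_invsq_derive x : x != 0 -> is_derive x (1 : R) half_invsq (- x ^- 3).
Proof.
move=> x0.
have -> : half_invsq = (2^-1 : R) \*: (fun y : R => (y ^+ 2)^-1).
  by apply/funext => y; rewrite /half_invsq /= mulrC.
have d2 : is_derive x (1 : R) (fun y : R => y ^+ 2) (2 * x).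
  have -> : (fun y : R => y ^+ 2) = (@idfun R) ^+ 2 by [].
  by apply: is_derive_eq; rewrite /= expr1 scaler1.
have x20 : x ^+ 2 != 0 by rewrite expf_neq0.
have D := @is_deriveZ _ _ _ _ (2^-1 : R) _ _ _ (is_deriveV (f := fun y : R => y ^+ 2) x20 d2).
apply: is_derive_eq.
by rewrite /GRing.scale /=; field.
Qed.

Lemma half_invsq_continuous x : x != 0 -> {for x, continuous half_invsq}.
Proof.
move=> x0; apply/differentiable_continuous/derivable1_diffP.
by have [] := half_invsq_derive x0.
Qed.

(** An antiderivative of [x ^- 3] is [- half_invsq]. The interval is closed on the left because
    [half_invsq] is decreasing on positive reals and so pulls intervals []u, v]] back to this
    shape. *)
Lemma integral_invcube (a b : R) : 0 < a -> a < b ->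
  (\int[mu]_(x in `[a, b[) (x ^- 3)%:E = (half_invsq a - half_invsq b)%:E)%E.
Proof.
move=> a0 ab.
have pos x : x \in `[a, b] -> 0 < x by rewrite in_itv/= => /andP[ax _]; exact: lt_le_trans ax.
have pos' x : x \in `]a, b[ -> 0 < x by rewrite in_itv/= => /andP[ax _]; exact: lt_trans ax.
rewrite integral_itv_bndo_bndc; last first.
  apply/measurable_funTS/measurable_EFinP.
  apply: (measurableT_comp (@measurable_invr R)) => //.
rewrite (@continuous_FTC2 _ _ (- half_invsq)%R)// /=.
- by rewrite -EFinB !fctE opprK addrC.
- apply: continuous_in_subspaceT => x /[!inE] /= /pos x0.
  apply: cvgV; first by rewrite expf_neq0// gt_eqF.
  exact: exprn_continuous.
- split.
  + move=> x /pos' x0; have [d _] := @half_invsq_derive x (lt0r_neq0 x0).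
    exact: derivableN.
  + by apply: cvg_at_right_filter; apply: cvgN; apply: half_invsq_continuous; rewrite gt_eqF.
  + by apply: cvg_at_left_filter; apply: cvgN; apply: half_invsq_continuous; rewrite gt_eqF// (lt_trans a0).
- move=> x /pos' x0; have D := @half_invsq_derive x (lt0r_neq0 x0).
  by rewrite derive1E (@derive_val _ _ _ _ _ _ _ (is_deriveN D)) opprK.
Qed.

Lemma measurable_half_invsq : measurable_fun setT half_invsq.
Proof.
apply: measurable_funM => //.
exact: (measurableT_comp (@measurable_invr R) (measurable_funX 2 (@measurable_id _ _ setT))).
Qed.

Lemma ltr_half_invsq x u : 0 < x -> 0 < u -> (half_invsq x < half_invsq u) = (u < x).
Proof.
move=> x0 u0; rewrite /half_invsq ltr_pM2r ?invr_gt0//.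
by rewrite ltf_pV2 ?posrE ?exprn_gt0// ltr_pXn2r// nnegrE ltW.
Qed.

Lemma half_invsqK u : 0 < u -> half_invsq (Num.sqrt (2 * u))^-1 = u.
Proof.
move=> u0; rewrite /half_invsq exprVn invrK sqr_sqrtr ?mulr_ge0 ?(ltW u0)//.
by rewrite mulrC mulKf.
Qed.

Lemma integral_half_invsq_le (f : R -> \bar R) :
  measurable_fun setT f -> (forall u, 0 <= f u)%E ->
  (\int[mu]_x ((x ^- 3 * \1_(`]0%R, 1%R[%classic : set R) x)%:E * f (half_invsq x)) <= \int[mu]_u f u)%E.
Proof.
move=> mf f0.
(* [kdensity] expects a parametrized density; the parameter here is the dummy [tt]. *)
pose h (z : unit * RT) : R := z.2 ^- 3 * \1_(`]0%R, 1%R[%classic : set R) z.2.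
have mh : measurable_fun setT h.
  apply: measurable_funM.
    apply: (measurableT_comp (@measurable_invr R)).
    by apply: measurable_funX; exact: measurable_snd.
  by apply: (measurableT_comp _ measurable_snd).
have hE x : h (tt, x) = if x \in (`]0%R, 1%R[%classic : set R) then x ^- 3 else 0.
  by rewrite /h indicE /=; case: ifPn => _; rewrite ?mulr1 ?mulr0.
have h0 z : 0 <= h z.
  case: z => -[] x; rewrite hE; case: ifPn => //; rewrite inE/= in_itv/= => /andP[x0 _].
  by rewrite invr_ge0 exprn_ge0// ltW.
have mphi : measurable_fun [set: RT] (half_invsq : RT -> RT) by exact: measurable_half_invsq.
pose pf : {measure set RT -> \bar R} :=
  measure_function_pushforward__canonical__measure_function_Measure (kdensity mu mh h0 tt) mphi.
have mD : measurable (`]-oo, 2^-1] : set RT) by [].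
pose rest : {measure set RT -> \bar R} := mrestr mu mD.
(* Under half_invsq, x ^- 3 dx on (0, 1) becomes du on (1/2, +oo); adding Lebesgue measure
   on (-oo, 1/2] recovers Lebesgue measure. *)
have key A : measurable A -> mu A = measure_add pf rest A.
  apply: lebesgue_measure_unique => _ [[a b]] _ <- /=.
  rewrite [RHS]measure_addE.
  have pfE : pf `]a, b]%classic = (\int[mu]_(x in half_invsq @^-1` `]a, b]%classic) (h (tt, x))%:E)%E by [].
  have restE : rest `]a, b]%classic = mu (`]a, b]%classic `&` `]-oo, 2^-1]%classic) by [].
  have [ab|ba] := ltP a b; last first.
    by rewrite set_itv_ge ?bnd_simp -?leNgt// !measure0 adde0.
  have half1 : half_invsq 1 = 2^-1 by rewrite /half_invsq expr1n invr1 mul1r.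
  have [b2|b2] := leP b 2^-1.
    rewrite pfE integral0_eq ?add0e; last first.
      move=> x /=; rewrite in_itv/= => /andP[_ xb]; rewrite hE; case: ifPn => //.
      rewrite inE/= in_itv/= => /andP[x0 x1].
      have : half_invsq 1 < half_invsq x by rewrite ltr_half_invsq.
      by rewrite half1 ltNge (le_trans xb).
    rewrite restE; congr (mu _); apply/seteqP; split => [x|x []//].
    by move=> /=; rewrite !in_itv/= => /andP[ax xb]; rewrite ax xb (le_trans xb).
  (* []c, b]] is the part of []a, b]] above 1/2, and [s] inverts [half_invsq] on positive reals. As
     [x < 1] means [half_invsq x > 1/2], the two constraints bounding [half_invsq x] below combine
     into [x < s c]. *)
  pose c := Num.max a 2^-1.
  have c0 : 0 < c by rewrite lt_max invr_gt0 ltr0n orbT.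
  have cb : c < b by rewrite gt_max ab.
  have b0 : 0 < b by exact: lt_trans cb.
  pose s (v : R) := (Num.sqrt (2 * v))^-1.
  have s0 v : 0 < v -> 0 < s v by move=> v0; rewrite invr_gt0 sqrtr_gt0 mulr_gt0.
  have -> : pf `]a, b]%classic = (b - c)%:E.
    transitivity (\int[mu]_(x in `[s b, s c[) (x ^- 3)%:E)%E; last first.
      rewrite integral_invcube ?s0 ?half_invsqK//.
      by rewrite -ltr_half_invsq ?s0// !half_invsqK.
    rewrite pfE integral_mkcond [RHS]integral_mkcond; apply: eq_integral => x _.
    rewrite !patchE hE.
    have E : (x \in half_invsq @^-1` `]a, b]%classic) && (x \in (`]0%R, 1%R[%classic : set R)) =
        (x \in (`[s b, s c[%classic : set R)).
      rewrite !mem_setE /= !in_itv /=.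
      have [x0|x0] := ltP 0 x; last first.
        by rewrite andbF; apply/esym/negbTE; rewrite negb_and -ltNge (le_lt_trans x0) ?s0.
      rewrite [s b <= x]leNgt -[x < s b]ltr_half_invsq ?s0// -[x < s c]ltr_half_invsq ?s0//.
      rewrite -[x < 1]ltr_half_invsq// !half_invsqK// half1 gt_max -leNgt.
      by rewrite -andbA andbCA.
    by rewrite -E; case: (x \in half_invsq @^-1` _); case: (x \in _).
  rewrite restE.
  have -> : `]a, b]%classic `&` `]-oo, 2^-1]%classic = `]a, 2^-1]%classic :> set R.
    apply/seteqP; split => x /=; rewrite !in_itv/=.
      by move=> -[/andP[-> _] ->].
    by move=> /andP[-> x2]; split => //; rewrite (le_trans x2)// ltW.
  rewrite !lebesgue_measure_itv/= !lte_fin ab /c.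
  have [a2|a2] := ltP a 2^-1; rewrite -?EFinB -?EFinD;
    by congr EFin; lra.
rewrite [leRHS](_ : _ = \int[measure_add pf rest]_u f u)%E; last first.
  by apply: eq_measure_integral => A mA _; exact: key.
rewrite ge0_integral_measure_add//.
apply: (@le_trans _ _ (\int[pf]_u f u)%E); last first.
  by rewrite leeDl// integral_ge0.
have := ge0_integral_pushforward mphi (kdensity mu mh h0 tt) (measurableT : measurable [set: RT]) mf.
rewrite preimage_setT => pfE; rewrite [leRHS]pfE; last by move=> x _; exact: f0.
rewrite integral_kdensity//.
  exact: (measurableT_comp mf mphi).
by move=> x; exact: f0.
Qed.

End change_of_variables.

(** * The bridge Gibbs sampler *)

Section bridge_weights.
Context {R : realType}.
Local Notation RT := (measurableTypeR R).
Local Notation mu := (@lebesgue_measure R).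

Lemma measurable_div_density (f : density R) : measurable_fun setT (fun x : R => x^-1 * f x).
Proof.
by apply: measurable_funM; [exact: measurable_invr|exact: measurable_density].
Qed.

Lemma div_density_ge0 (f : density R) x : 0 <= x^-1 * f x.
Proof.
have [x0|x0] := leP x 0; first by rewrite density_le0// mulr0.
by rewrite mulr_ge0 ?density_ge0// invr_ge0 ltW.
Qed.

(** All the mass of a [density] sits on the positive half-line, where [g] is positive. *)
Lemma integral_mul_density_gt0 (f : density R) (g : R -> R) :
  measurable_fun setT g -> (forall x, 0 < x -> 0 < g x) ->
  (0 < \int[mu]_x (g x * f x)%:E)%E.
Proof.
move=> mg g0.
have pos (h : R -> R) : (\int[mu]_x (h x * f x)%:E = \int[mu]_(x in `]0%R, +oo[) (h x * f x)%:E)%E.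
  rewrite [RHS]integral_mkcond; apply: eq_integral => x _; rewrite patchE.
  case: ifPn => //; rewrite notin_setE/= in_itv/= andbT => /negP; rewrite -leNgt => x0.
  by rewrite density_le0// mulr0.
rewrite pos; apply: integral_mul_gt0 => //.
- exact: measurable_density.
- by move=> x _; exact: density_ge0.
- by move=> x /=; rewrite in_itv/= andbT => /g0.
have fE D : (\int[mu]_(x in D) (cst 1 x * f x)%:E = \int[mu]_(x in D) (f x)%:E)%E.
  by apply: eq_integral => x _; rewrite /= mul1r.
by rewrite -fE -pos fE integral_density.
Qed.

(** For [x >= 1] the integrand is at most [pi_loc x]. For [0 < x < 1] it equals
    [c * x ^- 3 * pi_st (half_invsq x)], whose integral is at most [c] by the substitution. The
    total is at most [1 + c]. *)
Lemma bridge_inverse_moment (pi_st pi_loc : density R) :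
  bridge_local_prior pi_st pi_loc -> (\int[mu]_x (x^-1 * pi_loc x)%:E < +oo)%E.
Proof.
move=> [c c0 locE].
pose g x := x ^- 3 * \1_(`]0%R, 1%R[%classic : set R) x * pi_st (half_invsq x).
have g0 x : 0 <= g x.
  rewrite /g indicE; case: (boolP (x \in _)); last by rewrite mulr0 mul0r.
  rewrite inE/= in_itv/= mulr1 => /andP[x0 _].
  by rewrite mulr_ge0 ?density_ge0// invr_ge0 exprn_ge0// ltW.
have mg : measurable_fun setT g.
  apply: measurable_funM; last first.
    exact: (measurableT_comp (measurable_density pi_st) measurable_half_invsq).
  apply: measurable_funM => //.
  exact: (measurableT_comp (@measurable_invr R) (measurable_funX 3 (@measurable_id _ _ setT))).
have ptw x : x^-1 * pi_loc x <= pi_loc x + c * g x.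
  have cg : 0 <= c * g x by rewrite mulr_ge0// ltW.
  have [x0|x0] := leP x 0; first by rewrite density_le0// mulr0 add0r.
  have [x1|x1] := leP 1 x.
    apply: (@le_trans _ _ (pi_loc x)); last by rewrite lerDl.
    by rewrite ler_piMl ?density_ge0// invf_le1.
  rewrite (@le_trans _ _ (c * g x))//; last by rewrite lerDr density_ge0.
  rewrite /g indicE mem_set/= ?in_itv/= ?x0// mulr1 locE// /half_invsq.
  rewrite le_eqVlt; apply/orP; left; apply/eqP.
  by move: (pi_st _) => v; field; rewrite gt_eqF.
apply: (@le_lt_trans _ _ (\int[mu]_x ((pi_loc x)%:E + (c * g x)%:E))%E).
  apply: ge0_le_integral => //.
  - by move=> x _; rewrite lee_fin div_density_ge0.
  - by apply/measurable_EFinP; exact: measurable_div_density.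
  - by apply: emeasurable_funD; apply/measurable_EFinP; [exact: measurable_density|exact: measurable_funM].
  - by move=> x _; rewrite -EFinD lee_fin.
rewrite ge0_integralD//; last 4 first.
- by move=> x _; rewrite lee_fin density_ge0.
- by apply/measurable_EFinP; exact: measurable_density.
- by move=> x _; rewrite lee_fin mulr_ge0// ltW.
- by apply/measurable_EFinP; exact: measurable_funM.
rewrite integral_density.
rewrite (_ : integral _ _ _ = c%:E * \int[mu]_x (g x)%:E)%E; last first.
  under eq_integral do rewrite EFinM.
  rewrite ge0_integralZl_EFin//; last exact: ltW.
  - by move=> x _; rewrite lee_fin.
  - exact/measurable_EFinP.
have g1 : (\int[mu]_x (g x)%:E <= 1)%E.
  rewrite -(integral_density pi_st).
  under eq_integral do rewrite EFinM.
  apply: integral_half_invsq_le => [|x]; last by rewrite lee_fin density_ge0.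
  by apply/measurable_EFinP; exact: measurable_density.
apply: (@le_lt_trans _ _ (1 + c%:E * 1)%E); last by rewrite mule1 -EFinD ltry.
by rewrite leeD2l// lee_pmul2l// lte_fin.
Qed.

(** * The conditional law of a local scale *)

Section local_scale.
Variables (pi_loc : density R).
Hypothesis moment : (\int[mu]_x (x^-1 * pi_loc x)%:E < +oo)%E.

(** Separates the exponential tilt, the only factor involving [b] and [t], from the common
    weight. *)
Lemma lambda_weightE (b t x : R) : lambda_weight pi_loc b t x =
  expR (- (b ^+ 2 / (2 * t ^+ 2) / x ^+ 2)) * (x^-1 * pi_loc x).
Proof.
rewrite /lambda_weight [_^-1 * expR _]mulrC -[LHS]mulrA; congr (expR (- _) * _).
by rewrite invfM mulrA.
Qed.

Lemma measurable_lambda_weight (b t : R) : measurable_fun setT (lambda_weight pi_loc b t).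
Proof.
rewrite (_ : lambda_weight _ _ _ = fun x => expR (- (b ^+ 2 / (2 * t ^+ 2) / x ^+ 2)) * (x^-1 * pi_loc x)).
  apply: measurable_funM; last exact: measurable_div_density.
  apply: (measurableT_comp (@measurable_expR R)).
  apply: measurable_funN; apply: measurable_funM => //.
  exact: (measurableT_comp (@measurable_invr R) (measurable_funX 2 (@measurable_id _ _ setT))).
by apply/funext => x; exact: lambda_weightE.
Qed.

Lemma integral_lambda_weight_gt0 (b t : R) :
  (0 < \int[mu]_x (lambda_weight pi_loc b t x)%:E)%E.
Proof.
pose g x := expR (- (b ^+ 2 / (2 * t ^+ 2) / x ^+ 2)) * x^-1.
rewrite (eq_integral (fun x : RT => (g x * pi_loc x)%:E)); last first.
  by move=> x _; rewrite lambda_weightE /g mulrA.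
apply: integral_mul_density_gt0 => [|x x0]; last by rewrite mulr_gt0 ?expR_gt0 ?invr_gt0.
apply: measurable_funM; last exact: measurable_invr.
apply: (measurableT_comp (@measurable_expR R)).
apply: measurable_funN; apply: measurable_funM => //.
exact: (measurableT_comp (@measurable_invr R) (measurable_funX 2 (@measurable_id _ _ setT))).
Qed.

Lemma lambda_weight_le (b t x : R) : lambda_weight pi_loc b t x <= x^-1 * pi_loc x.
Proof.
rewrite lambda_weightE ler_piMl ?div_density_ge0// -expR0 ler_expR oppr_le0.
by rewrite divr_ge0 ?sqr_ge0// divr_ge0 ?sqr_ge0// mulr_ge0 ?sqr_ge0.
Qed.

Lemma integral_lambda_weight_lty (b t : R) :
  (\int[mu]_x (lambda_weight pi_loc b t x)%:E < +oo)%E.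
Proof.
apply: le_lt_trans moment; apply: ge0_le_integral => //.
- by move=> x _; rewrite lee_fin lambda_weight_ge0.
- by apply/measurable_EFinP; exact: measurable_lambda_weight.
- by apply/measurable_EFinP; exact: measurable_div_density.
- by move=> x _; rewrite lee_fin lambda_weight_le.
Qed.

(** With [M] the inverse moment, take [delta = (M + 1)^-1]. If the tail integral were 0, [f] would
    have no mass on [[delta, +oo[]; below [delta], [f x <= delta * (x^-1 * f x)]. Then the total
    mass 1 of [f] would be at most [delta * M < 1]. *)
Lemma density_tail_gt0 (f : density R) : (\int[mu]_x (x^-1 * f x)%:E < +oo)%E ->
  exists2 delta : R, 0 < delta & (0 < \int[mu]_(x in `[delta, +oo[) (x^-1 * f x)%:E)%E.
Proof.
move=> fM.
pose M := fine (\int[mu]_x (x^-1 * f x)%:E)%E.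
have ge0 D : (0 <= \int[mu]_(x in D) (x^-1 * f x)%:E)%E.
  by apply: integral_ge0 => x _; rewrite lee_fin div_density_ge0.
have ME : (\int[mu]_x (x^-1 * f x)%:E = M%:E)%E by rewrite /M fineK// ge0_fin_numE.
have M0 : 0 <= M by rewrite -lee_fin -ME.
pose delta := (M + 1)^-1.
have d0 : 0 < delta by rewrite invr_gt0; lra.
exists delta => //; rewrite lt_neqAle eq_sym ge0 andbT; apply/eqP => tail0.
pose D : set RT := `[delta, +oo[%classic.
have mD : measurable D by exact: measurable_itv.
have tailf : (\int[mu]_(x in D) (f x)%:E = 0)%E.
  apply/eqP; rewrite eq_le integral_ge0 ?andbT; last by move=> x _; rewrite lee_fin density_ge0.
  rewrite leNgt; apply/negP => fD.
  have : (0 < \int[mu]_(x in D) (x^-1 * f x)%:E)%E.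
    apply: integral_mul_gt0 => //; [exact: measurable_density|exact: measurable_invr| |].
      by move=> x _; exact: density_ge0.
    by move=> x; rewrite /D/= in_itv/= andbT invr_gt0; exact: lt_le_trans.
  by rewrite tail0 ltxx.
have : (\int[mu]_x (f x)%:E <= delta%:E * M%:E)%E.
  rewrite -(setUv D) ge0_integral_setU//; last 4 first.
  - exact: measurableC.
  - by apply: measurable_funTS; apply/measurable_EFinP; exact: measurable_density.
  - by move=> x _; rewrite lee_fin density_ge0.
  - by rewrite disj_set2E setICr.
  rewrite tailf add0e -ME -ge0_integralZl_EFin//; last 3 first.
  - by move=> x _; rewrite lee_fin div_density_ge0.
  - by apply/measurable_EFinP; exact: measurable_div_density.
  - exact: ltW.
  apply: (@le_trans _ _ (\int[mu]_(x in ~` D) (delta%:E * (x^-1 * f x)%:E))%E); last first.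
    apply: ge0_subset_integral => //; first exact: measurableC.
    - by apply/measurable_EFinP; apply: measurable_funM => //; exact: measurable_div_density.
    - by move=> x _; rewrite lee_fin mulr_ge0 ?div_density_ge0// ltW.
  apply: ge0_le_integral => //; first exact: measurableC.
  - by move=> x _; rewrite lee_fin density_ge0.
  - by apply: measurable_funTS; apply/measurable_EFinP; exact: measurable_density.
  - by apply: measurable_funTS; apply/measurable_EFinP; apply: measurable_funM => //; exact: measurable_div_density.
  move=> x; rewrite /D/= in_itv/= andbT => /negP; rewrite -ltNge => xd.
  rewrite -EFinM lee_fin; have [x0|x0] := leP x 0.
    by rewrite density_le0// !mulr0.
  by rewrite mulrA ler_peMl ?density_ge0// ler_pdivlMr// mul1r ltW.
rewrite integral_density -EFinM lee_fin /delta.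
by rewrite mulrC ler_pdivlMr; lra.
Qed.

(* Tilting by the increasing factor exp(- s / x^2) only moves mass to larger x, so
   the untilted tail probability is a lower bound for all b and t. *)
Lemma lambda_weight_tail : exists delta q : R, [/\ 0 < delta, 0 < q &
  forall b t, (q%:E * \int[mu]_x (lambda_weight pi_loc b t x)%:E <=
    \int[mu]_(x in `[delta, +oo[) (lambda_weight pi_loc b t x)%:E)%E].
Proof.
have [delta d0 tail0] := density_tail_gt0 moment.
pose D : set RT := `[delta, +oo[%classic.
have mD : measurable D by exact: measurable_itv.
have mDC : measurable (~` D) by exact: measurableC.
have split_ (h : R -> R) : measurable_fun setT h -> (forall x, 0 <= h x) ->
    (\int[mu]_x (h x)%:E < +oo)%E -> exists a c : R, [/\ 0 <= a, 0 <= c,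
    (\int[mu]_(x in D) (h x)%:E = a%:E)%E, (\int[mu]_(x in ~` D) (h x)%:E = c%:E)%E &
    (\int[mu]_x (h x)%:E = (a + c)%:E)%E].
  move=> mh h0; rewrite -(setUv D) ge0_integral_setU//; last 3 first.
  - by apply: measurable_funTS; apply/measurable_EFinP.
  - by move=> x _; rewrite lee_fin.
  - by rewrite disj_set2E setICr.
  have : (0 <= \int[mu]_(x in D) (h x)%:E)%E by apply: integral_ge0 => x _; rewrite lee_fin.
  have : (0 <= \int[mu]_(x in ~` D) (h x)%:E)%E by apply: integral_ge0 => x _; rewrite lee_fin.
  case: (integral mu (~` D) _) => [c| |] //; case: (integral mu D _) => [a| |] //.
  by rewrite !lee_fin => c0 a0 _; exists a, c.
have [A [C [A0 C0 AE CE ACE]]] := split_ _ (measurable_div_density pi_loc) (div_density_ge0 pi_loc) moment.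
have Agt0 : 0 < A by rewrite -lte_fin -AE.
have AC0 : 0 < A + C + 1 by lra.
(* [A] and [C] are the untilted masses of [D] and of its complement, [N] and [W] below the tilted
   ones. With this [q] the goal reduces to [A * W <= C * N + N]. *)
exists delta, (A / (A + C + 1)); split => //.
  by rewrite divr_gt0.
move=> b t.
have [N [W [N0 W0 NE WE NWE]]] := split_ _ (measurable_lambda_weight b t)
  (lambda_weight_ge0 pi_loc b t) (integral_lambda_weight_lty b t).
rewrite -/D NE NWE -EFinM lee_fin.
(* The tilt at [delta]: it is a lower bound for the tilt on [D] and an upper bound on []0, delta[].
   Hence [A * W <= e * A * C <= C * N]. *)
pose e := expR (- (b ^+ 2 / (2 * t ^+ 2) / delta ^+ 2)).
have e0 : 0 < e by exact: expR_gt0.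
have s0 : 0 <= b ^+ 2 / (2 * t ^+ 2) by rewrite divr_ge0 ?sqr_ge0// mulr_ge0 ?sqr_ge0.
have eA : e * A <= N.
  rewrite -lee_fin -NE EFinM -AE -ge0_integralZl_EFin//; last 3 first.
  - by move=> x _; rewrite lee_fin div_density_ge0.
  - by apply: measurable_funTS; apply/measurable_EFinP; exact: measurable_div_density.
  - exact: ltW.
  apply: ge0_le_integral => //.
  - by move=> x _; rewrite mule_ge0 ?lee_fin ?div_density_ge0// ltW.
  - by apply: measurable_funTS; apply/measurable_EFinP; apply: measurable_funM => //; exact: measurable_div_density.
  - by apply: measurable_funTS; apply/measurable_EFinP; exact: measurable_lambda_weight.
  move=> x; rewrite /D/= in_itv/= andbT => dx.
  have x0 : 0 < x by exact: lt_le_trans dx.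
  rewrite -EFinM lee_fin lambda_weightE ler_wpM2r ?div_density_ge0// ler_expR lerN2.
  by rewrite ler_wpM2l// lef_pV2 ?posrE ?exprn_gt0// ler_pXn2r ?nnegrE// ltW.
have eC : W <= e * C.
  rewrite -lee_fin -WE EFinM -CE -ge0_integralZl_EFin//; last 3 first.
  - by move=> x _; rewrite lee_fin div_density_ge0.
  - by apply: measurable_funTS; apply/measurable_EFinP; exact: measurable_div_density.
  - exact: ltW.
  apply: ge0_le_integral => //.
  - by move=> x _; rewrite lee_fin lambda_weight_ge0.
  - by apply: measurable_funTS; apply/measurable_EFinP; exact: measurable_lambda_weight.
  - by apply: measurable_funTS; apply/measurable_EFinP; apply: measurable_funM => //; exact: measurable_div_density.
  move=> x; rewrite /D/= in_itv/= andbT => /negP; rewrite -ltNge => xd.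
  rewrite -EFinM lee_fin lambda_weightE.
  have [x0|x0] := leP x 0; first by rewrite density_le0// !mulr0.
  rewrite ler_wpM2r ?div_density_ge0// ler_expR lerN2.
  by rewrite ler_wpM2l// lef_pV2 ?posrE ?exprn_gt0// ler_pXn2r ?nnegrE// ltW.
rewrite mulrAC ler_pdivrMr//.
have h1 : A * W <= A * (e * C) by rewrite ler_wpM2l.
have h2 : C * (e * A) <= C * N by rewrite ler_wpM2l.
have h3 : 0 <= N by [].
by rewrite mulrDr !mulrDr; nra.
Qed.

End local_scale.
End bridge_weights.

(** * Minorization for the sampler *)

Section gibbs_minorization.
Context {R : realType} (n p : nat).
Local Notation RT := (measurableTypeR R).
Local Notation vec := (p.-tuple RT).
Local Notation state := (vec * vec * RT)%type.
Local Notation mu := (@lebesgue_measure R).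

Variables (X : 'M[R]_(n, p)) (y : 'I_n -> bool) (zeta a tau_min : R).
Variables (pi_loc pi_glo : density R).
Hypotheses (zeta_gt0 : 0 < zeta) (tau_min_gt0 : 0 < tau_min).
Hypothesis moment : (\int[mu]_x (x^-1 * pi_loc x)%:E < +oo)%E.
Hypothesis glo_support : forall tau, tau < tau_min -> pi_glo tau = 0.

(** The fallback point mass at 0 lies outside this interval, so the total weight must be shown
    positive and finite. Finiteness holds because the weight is at most
    [tau_min ^- p * pi_glo tau]. *)
Lemma tau_draw_support (s : state) : (1%:E <= tau_draw p a pi_glo s `[tau_min, +oo[%classic)%E.
Proof.
have mw : measurable_fun [set: RT] (fun tau : RT => tau_density a pi_glo (s, tau)).
  exact: (measurable_fun_pair2 s (measurable_tau_density a pi_glo)).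
apply: kdraw_full => //=.
- pose g tau := tau ^- p * \prod_(j < p) expR (- (`|tnth s.1.1 j / tau| `^ a)).
  rewrite (eq_integral (fun tau : RT => (g tau * pi_glo tau)%:E)); last first.
    by move=> tau _; rewrite /tau_density /tau_weight /g /= -mulrA mulrC.
  apply: integral_mul_density_gt0 => [|tau tau0]; last first.
    by rewrite mulr_gt0 ?invr_gt0 ?exprn_gt0// prodr_gt0// => j _; exact: expR_gt0.
  apply: measurable_funM; first exact: (measurableT_comp (@measurable_invr R) (measurable_funX p (@measurable_id _ _ setT))).
  apply: measurable_prod => j _; apply: (measurableT_comp (@measurable_expR R)).
  apply: measurable_funN; apply: (measurableT_comp (@measurable_powR R a)).
  apply: (measurableT_comp (@normr_measurable R setT)).
  by apply: measurable_funM => //; exact: measurable_invr.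
- apply: (@le_lt_trans _ _ (\int[mu]_tau ((tau_min ^- p)%:E * (pi_glo tau)%:E))%E).
    apply: ge0_le_integral => //.
    + by move=> tau _; rewrite lee_fin tau_weight_ge0.
    + exact/measurable_EFinP.
    + apply: emeasurable_funM => //; apply/measurable_EFinP; exact: measurable_density.
    move=> tau _; rewrite -EFinM lee_fin /tau_density /tau_weight /=.
    have [taum|taum] := ltP tau tau_min; first by rewrite glo_support// !mul0r mulr0.
    have tau0 : 0 < tau by exact: lt_le_trans taum.
    rewrite mulrAC -mulrA [leRHS]mulrC ler_wpM2l ?density_ge0//.
    apply: (@le_trans _ _ (tau ^- p)); last first.
      by rewrite lef_pV2 ?posrE ?exprn_gt0// lerXn2r ?nnegrE// ltW.
    rewrite ler_piMl ?invr_ge0 ?exprn_ge0 ?(ltW tau0)//.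
    apply: prodr_ile1 => j _; rewrite expR_ge0 -expR0 ler_expR oppr_le0.
    exact: powR_ge0.
  rewrite ge0_integralZl_EFin//; last 3 first.
  + by move=> tau _; rewrite lee_fin density_ge0.
  + by apply/measurable_EFinP; exact: measurable_density.
  + by rewrite invr_ge0 exprn_ge0// ltW.
  by rewrite integral_density mule1 ltry.
- move=> tau; rewrite in_itv/= andbT => /negP; rewrite -ltNge => taum.
  by rewrite /tau_density /tau_weight glo_support// !mul0r.
Qed.

Lemma lambda_draw_support (z : state * RT) :
  (1%:E <= lambda_draw p pi_loc z [set t | forall j, `]0%R, +oo[%classic (tnth t j)])%E.
Proof.
rewrite -[X in X%:E](expr1n _ p); apply: kindep_ge => // j.
apply: kdraw_full => //.
- exact: (integral_lambda_weight_gt0 pi_loc (tnth z.1.1.1 j) z.2).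
- exact: (integral_lambda_weight_lty moment (tnth z.1.1.1 j) z.2).
- move=> l; rewrite /= in_itv/= andbT => /negP; rewrite -leNgt => l0.
  by rewrite /lambda_density /lambda_weight density_le0// mulr0.
Qed.

Lemma lambda_draw_tail : exists delta q : R, [/\ 0 < delta, 0 < q & forall z : state * RT,
  (q%:E <= lambda_draw p pi_loc z [set t | forall j, `[delta, +oo[%classic (tnth t j)])%E].
Proof.
have [delta [q [d0 q0 tail]]] := lambda_weight_tail moment.
exists delta, (q ^+ p); split => //; first exact: exprn_gt0.
move=> z; apply: kindep_ge => //; first exact: ltW.
move=> j; apply: kdraw_ge => //.
- exact: (integral_lambda_weight_gt0 pi_loc (tnth z.1.1.1 j) z.2).
- exact: (integral_lambda_weight_lty moment (tnth z.1.1.1 j) z.2).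
- exact: (tail (tnth z.1.1.1 j) z.2).
Qed.

Lemma beta_weight_gt0 (tau : R) (lambda beta : vec) : 0 < beta_weight X y zeta tau lambda beta.
Proof.
rewrite mulr_gt0//; apply: prodr_gt0 => i _; last exact: expR_gt0.
by rewrite mulr_gt0// exprn_gt0// ?Phi_gt0// subr_gt0 Phi_lt1.
Qed.

(** The likelihood is at most 1, and dropping the prior precision leaves only the slab. *)
Lemma beta_weight_le (tau : R) (lambda beta : vec) : beta_weight X y zeta tau lambda beta <=
  \prod_(j < p) expR (- (2^-1 * zeta ^- 2 * tnth beta j ^+ 2)).
Proof.
rewrite /beta_weight -[leRHS]mul1r; apply: ler_pM.
- by apply: prodr_ge0 => i _; rewrite mulr_ge0 ?exprn_ge0 ?subr_ge0 ?Phi_le1 ?Phi_ge0.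
- by apply: prodr_ge0 => j _; exact: expR_ge0.
- apply: prodr_ile1 => i _; rewrite mulr_ge0 ?exprn_ge0 ?subr_ge0 ?Phi_le1 ?Phi_ge0//=.
  rewrite mulr_ile1 ?exprn_ge0 ?subr_ge0 ?Phi_le1 ?Phi_ge0//.
    by rewrite exprn_ile1 ?Phi_le1 ?Phi_ge0.
  by rewrite exprn_ile1 ?subr_ge0 ?Phi_le1// lerBlDr lerDl Phi_ge0.
- apply: ler_prod => j _; rewrite expR_ge0 ler_expR lerN2.
  rewrite ler_wpM2r ?sqr_ge0// ler_wpM2l// lerDl.
  by rewrite mulr_ge0 ?invr_ge0 ?sqr_ge0.
Qed.

Lemma beta_weight_mono (tau0 tau : R) (lambda0 lambda beta : vec) :
  0 < tau0 -> tau0 <= tau -> (forall j, 0 < tnth lambda0 j :> R) ->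
  (forall j, tnth lambda0 j <= tnth lambda j :> R) ->
  beta_weight X y zeta tau0 lambda0 beta <= beta_weight X y zeta tau lambda beta.
Proof.
move=> tau00 tau0tau l0 l0l; rewrite /beta_weight ler_wpM2l//.
  by apply: prodr_ge0 => i _; rewrite mulr_ge0 ?exprn_ge0 ?subr_ge0 ?Phi_le1 ?Phi_ge0.
have inv2 (u v : R) : 0 < u -> u <= v -> v ^- 2 <= u ^- 2.
  move=> u0 uv; have v0 : 0 < v by exact: lt_le_trans uv.
  by rewrite lef_pV2 ?posrE ?exprn_gt0// ler_pXn2r ?nnegrE// ltW.
apply: ler_prod => j _; rewrite expR_ge0 ler_expR lerN2.
rewrite ler_wpM2r ?sqr_ge0// ler_wpM2l// lerD2l.
by apply: ler_pM; rewrite ?invr_ge0 ?sqr_ge0// inv2.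
Qed.

(** The weight at [(tau0, lambda0)] bounds the weights from below and the Gaussian envelope, of mass
    [c ^+ p], bounds every normalizing constant from above; [kappa] is the ratio of the two masses.
    The states are placeholders, since the weight reads only tau and lambda. *)
Lemma beta_draw_minorization (s0 : state) (tau0 : R) (lambda0 : vec) :
  0 < tau0 -> (forall j, 0 < tnth lambda0 j :> R) ->
  exists2 kappa : R, 0 < kappa & forall (s : state) (tau : R) (lambda : vec) A,
    measurable A -> tau0 <= tau -> (forall j, tnth lambda0 j <= tnth lambda j :> R) ->
    (kappa%:E * beta_draw X y zeta (s0, tau0, lambda0) A <=
     beta_draw X y zeta (s, tau, lambda) A)%E.
Proof.
move=> tau00 l0; have [c c0 cE] := integral_gauss zeta_gt0.
have mgauss : measurable_fun setT (fun x : R => expR (- (2^-1 * zeta ^- 2 * x ^+ 2))).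
  apply: (measurableT_comp (@measurable_expR R)).
  by apply: measurable_funN; apply: measurable_funM => //; exact: measurable_funX.
have massle z : (\int[@lebesgue_tuple R p]_b (beta_density X y zeta (z, b))%:E <= (c ^+ p)%:E)%E.
  rewrite -(integral_lebesgue_tuple_prod p mgauss _ cE); last by move=> x; exact: expR_ge0.
  apply: ge0_le_integral => //.
  - by move=> b _; rewrite lee_fin beta_weight_ge0.
  - apply/measurable_EFinP; exact: (measurable_fun_pair2 z (measurable_beta_density X y zeta)).
  - apply/measurable_EFinP; apply: measurable_prod => j _.
    exact: (measurableT_comp mgauss (measurable_tnth j)).
  - by move=> b _; rewrite lee_fin beta_weight_le.
have mass0 z : (0 < \int[@lebesgue_tuple R p]_b (beta_density X y zeta (z, b))%:E)%E.
  apply: integral_gt0 => //.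
  - exact: (measurable_fun_pair2 z (measurable_beta_density X y zeta)).
  - by move=> b _; exact: beta_weight_gt0.
  - exact: lebesgue_tuple_setT_neq0.
pose m0 := (\int[@lebesgue_tuple R p]_b (beta_density X y zeta (s0, tau0, lambda0, b))%:E)%E.
exists (fine m0 / c ^+ p).
  rewrite divr_gt0 ?exprn_gt0// fine_gt0// mass0/=.
  by apply: le_lt_trans (massle _) _; rewrite ltry.
move=> s tau lambda A mA tau0tau l0l.
have cp0 : 0 < c ^+ p by exact: exprn_gt0.
pose z0 : state * RT * vec := (s0, tau0, lambda0).
pose z : state * RT * vec := (s, tau, lambda).
apply: (@kdraw_minorization _ _ _ _ _ _ _ (measurable_beta_density X y zeta)
  (fun z => beta_weight_ge0 X y zeta _ _ _) _ z z0 (c ^+ p) A mA cp0 (mass0 z0) (massle z)).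
by move=> b; exact: beta_weight_mono.
Qed.

Lemma gibbs_eq (s s' : state) : s.1.1 = s'.1.1 ->
  forall A, measurable A -> gibbs X y zeta a pi_loc pi_glo s A = gibbs X y zeta a pi_loc pi_glo s' A.
Proof.
move=> ss'; apply: kbind_eq => [U mU|tau U mU].
  by apply: kdraw_eq => tau; rewrite /tau_density /= ss'.
apply: kbind_eq => // V mV.
apply: (kindep_eq _ mV) => j W _; apply: kdraw_eq => l.
by rewrite /lambda_density /= ss'.
Qed.

Lemma measurable_box (i : interval R) :
  measurable [set t : vec | forall j, [set` i] (tnth t j)].
Proof. by apply: (@measurable_forall_tnth _ RT p (fun=> [set` i])) => j; exact: measurable_itv. Qed.

Lemma measurable_state_space : measurable (@state_space R p).
Proof.
have -> : @state_space R p =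
    (fun s : state => s.1.2) @^-1` [set t : vec | forall j, `]0%R, +oo[%classic (tnth t j)] `&`
    (fun s : state => s.2) @^-1` `]0%R, +oo[%classic.
  apply/seteqP; split => s /=.
    by move=> -[h1 h2]; split => [j|]; rewrite in_itv/= andbT.
  by move=> [h1]; rewrite in_itv/= andbT => h2; split => // j; have := h1 j; rewrite in_itv/= andbT.
apply: measurableI.
- have m12 : measurable_fun [set: state] (fun s : state => s.1.2).
    exact: (measurableT_comp measurable_snd measurable_fst).
  rewrite -[X in measurable X]setTI; apply: m12 => //; exact: measurable_box.
- by rewrite -[X in measurable X]setTI; exact: measurable_snd.
Qed.

(** Holds from every [s], even outside the state space: each draw lands in its support with
    probability 1. *)
Lemma gibbs_state_space (s : state) : gibbs X y zeta a pi_loc pi_glo s (@state_space R p) = 1%E.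
Proof.
have mS := measurable_state_space.
apply/eqP; rewrite eq_le; apply/andP; split.
  rewrite -(@prob_kernel _ _ _ _ _ (gibbs X y zeta a pi_loc pi_glo) s).
  by rewrite le_measure ?inE.
rewrite -[X in (X%:E <= _)%E](mulr1 1).
have mI : measurable (`[tau_min, +oo[ : set RT) by [].
apply: (kbind_ge mI mS) => //; first exact: tau_draw_support.
move=> tau /=; rewrite in_itv/= andbT => taum.
rewrite -[X in (X%:E <= _)%E](mulr1 1).
have mB : measurable [set t : vec | forall j, `]0%R, +oo[%classic (tnth t j)].
  exact: measurable_box.
apply: (kbind_ge mB mS) => //; first exact: lambda_draw_support.
move=> lambda l0.
rewrite -[X in (X%:E <= _)%E](mulr1 1).
apply: (kbind_ge measurableT mS) => //; first by rewrite prob_kernel.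
move=> beta _; rewrite /= diracE mem_set//; split => /=.
  by move=> j; have := l0 j; rewrite /= in_itv/= andbT.
exact: lt_le_trans taum.
Qed.

Theorem gibbs_uniformly_ergodic :
  uniformly_ergodic (@state_space R p) (gibbs X y zeta a pi_loc pi_glo).
Proof.
have [delta [q [d0 q0 tail]]] := lambda_draw_tail.
pose lambda0 : vec := [tuple of nseq p delta].
have l0E j : tnth lambda0 j = delta by rewrite tnth_nseq.
(* A state with the given beta and fixed filler scales. Thus [r] keeps only beta, and [nu] is the
   reference law of beta carried to states. *)
pose emb (beta : vec) : state := (beta, lambda0, tau_min).
have memb : measurable_fun setT emb.
  by apply: measurable_fun_pair => //; exact: measurable_fun_pair.
pose r (s : state) : state := emb s.1.1.
have mr : measurable_fun setT r.
  exact: (measurableT_comp memb (measurableT_comp measurable_fst measurable_fst)).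
have l00 j : 0 < tnth lambda0 j :> R by rewrite l0E.
have [kappa k0 kmin] := beta_draw_minorization point tau_min_gt0 l00.
pose base := beta_draw X y zeta (point, tau_min, lambda0).
pose nu : {measure set state -> \bar R} :=
  measure_function_pushforward__canonical__measure_function_Measure base memb.
have nu1 : nu setT = 1%E by exact: (@prob_kernel _ _ _ _ _ (beta_draw X y zeta) (point, tau_min, lambda0)).
(* The minimum with 1/2 keeps [eps] below 1. *)
pose eps := Num.min (kappa * q) 2^-1.
have eps0 : 0 < eps by rewrite lt_min mulr_gt0//= invr_gt0.
have eps1 : eps < 1 by rewrite gt_min; apply/orP; right; lra.
apply: (doeblin mr nu1 eps0 eps1 _ _ measurable_state_space gibbs_state_space).
  by move=> s A mA; exact: gibbs_eq.
move=> s A mA.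
have nufin : nu A \is a fin_num.
  rewrite ge0_fin_numE// (@le_lt_trans _ _ 1%E) ?ltry// -nu1 le_measure ?inE//.
rewrite -(fineK nufin); set v := fine _.
have v0 : 0 <= v by exact: fine_ge0.
have mrA : measurable (r @^-1` A) by rewrite -[X in measurable X]setTI; exact: (mr measurableT).
have mI : measurable (`[tau_min, +oo[ : set RT) by [].
have mB : measurable [set t : vec | forall j, `[delta, +oo[%classic (tnth t j)].
  exact: measurable_box.
have mE : measurable (emb @^-1` A) by rewrite -[X in measurable X]setTI; exact: (memb measurableT).
(* One factor per draw: 1 for [tau >= tau_min], [q] for all local scales being at least [delta], and
   [kappa * v] for the new beta. *)
apply: (@le_trans _ _ ((kappa * v * q) * 1)%:E).
  rewrite mulr1 -EFinM lee_fin [leRHS]mulrAC ler_wpM2r//.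
  by rewrite ge_min lexx.
apply: (kbind_ge mI mrA) => //; first by rewrite !mulr_ge0// ltW.
  exact: tau_draw_support.
move=> tau /=; rewrite in_itv/= andbT => taum.
apply: (kbind_ge mB mrA) => //; first by rewrite mulr_ge0// ltW.
move=> lambda lB.
rewrite -[X in (X%:E <= _)%E]mul1r.
apply: (kbind_ge mE mrA) => //; last first.
  by move=> beta bA; rewrite /= diracE mem_set.
rewrite EFinM /v fineK//; apply: kmin => // j.
by rewrite l0E; have := lB j; rewrite /= in_itv/= andbT.
Qed.

End gibbs_minorization.

Theorem theoremB1 (R : realType) (n p : nat) (X : 'M[R]_(n, p)) (y : 'I_n -> bool)
    (zeta a tau_min : R) (pi_st pi_loc pi_glo : density R) :
  0 < a -> a < 1 -> 0 < zeta -> 0 < tau_min ->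
  positive_stable_density (a / 2) pi_st ->
  bridge_local_prior pi_st pi_loc ->
  (forall tau, tau < tau_min -> pi_glo tau = 0) ->
  uniformly_ergodic (@state_space R p) (gibbs X y zeta a pi_loc pi_glo).
Proof.
move=> _ _ zeta0 tau0 _ bridge glo.
exact: (gibbs_uniformly_ergodic X y a zeta0 tau0 (bridge_inverse_moment bridge) glo).
Qed.
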